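(* Let $M$ and $A$ be the mass and stiffness matrices described in the context and let $\Delta t>0$ be the time step. Assume that the eigenvalues of the coefficient matrix $\Gamma\in\mathbb{R}^{s\times s}$ of a given implicit Runge--Kutta (RK) method have nonnegative real parts, and that the RK stage system $$M\boldsymbol{v}_k+\Delta t\,A\sum_{j=1}^s\gamma_{kj}\boldsymbol{v}_j=-A\boldsymbol{u}^n,\qquad k=1,\dots,s,$$ is solved by using the (real) Jordan normal form of $\Gamma$ to transform it into smaller systems. Then the conditioning of the implicit RK integration of $M\,\frac{d\boldsymbol{u}}{dt}=-A\boldsymbol{u}$ is determined by the conditioning of $$M+\mu_j\Delta t\,A\qquad\text{and}\qquad I_2\otimes M+\Delta t\,C_j\otimes A,\qquad C_j=\begin{bmatrix}\alpha_j&\beta_j\\-\beta_j&\alpha_j\end{bmatrix},$$ where $\mu_j$ and $\alpha_j\pm i\beta_j$ are the real and complex eigenvalues of $\Gamma$, respectively. Moreover, for any symmetric and positive definite preconditioner $P$, $$\tilde\kappa\left((I_2\otimes P^{-\frac12})(I_2\otimes M+\Delta t\,C_j\otimes A)(I_2\otimes P^{-\frac12})\right)\le\frac{\lambda_{\max}(P^{-\frac12}MP^{-\frac12})+\Delta t\sqrt{\alpha_j^2+\beta_j^2}\;\lambda_{\max}(P^{-\frac12}AP^{-\frac12})}{\lambda_{\min}(P^{-\frac12}MP^{-\frac12})+\Delta t\,\alpha_j\,\lambda_{\min}(P^{-\frac12}AP^{-\frac12})}.$$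
   Context: $\otimes$ is the Kronecker product, $I_n$ the $n\times n$ identity, $\sigma_{\max}$ the largest singular value, and $\lambda_{\min},\lambda_{\max}$ the extremal eigenvalues of a symmetric matrix. For a real square matrix $\mathbb{B}$ whose symmetric part is positive definite, the ''condition number'' used is $\tilde\kappa(\mathbb{B})=\sigma_{\max}(\mathbb{B})/\lambda_{\min}((\mathbb{B}+\mathbb{B}^T)/2)$, which for symmetric positive definite matrices is the standard condition number in the 2-norm. $\Gamma=(\gamma_{kj})_{k,j=1}^s$ is the coefficient matrix of an $s$-stage implicit RK method; the stage system has coefficient matrix $I_s\otimes M+\Delta t\,\Gamma\otimes A$, and $\boldsymbol{u}^n$ is the approximation at the current time level. Real Jordan normal form: $\Gamma=T\,\mathrm{diag}(J_1,\dots,J_p)\,T^{-1}$, where $T$ is a real invertible matrix and each Jordan block $J_j$ is either an upper bidiagonal matrix with a real eigenvalue $\mu_j$ on the diagonal and $1$ on the superdiagonal, or a block upper bidiagonal matrix with the $2\times2$ blocks $C_j$ ($\alpha_j,\beta_j\in\mathbb{R}$) on the diagonal and $I_2$ on the block superdiagonal. By the assumption on the eigenvalues of $\Gamma$, $\mu_j,\alpha_j\ge0$. $M_{kj}=\int_\Omega\phi_k\phi_j\,d\boldsymbol{x}$ and $A_{kj}=\int_\Omega\nabla\phi_k\cdot\mathbb{D}\nabla\phi_j\,d\boldsymbol{x}$, $k,j=1,\dots,N_{vi}$, where $\Omega\subset\mathbb{R}^d$ is a bounded polygonal or polyhedral domain, $\mathbb{D}(\boldsymbol{x})$ is symmetric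 with $d_{\min}I\le\mathbb{D}(\boldsymbol{x})\le d_{\max}I$ on $\Omega$ for some $d_{\min},d_{\max}>0$, and $\phi_j$ are the continuous piecewise linear nodal basis functions of the $N_{vi}$ interior vertices of a simplicial mesh of $\Omega$ (homogeneous Dirichlet conditions). The preconditioner $P$ is an $N_{vi}\times N_{vi}$ matrix. *)

(* Defs.v *)
From HB Require Import structures.
From mathcomp Require Import all_boot all_order all_algebra.
From mathcomp Require Import all_classical all_reals all_analysis.
From mathcomp Require Import complex mxtens.

Set Implicit Arguments.
Unset Strict Implicit.
Unset Printing Implicit Defensive.

Import Order.TTheory GRing.Theory Num.Theory.
Import numFieldNormedType.Exports.

Local Open Scope classical_set_scope.
Local Open Scope ring_scope.

Section measurable_rV.
Context {R : realType} {d : nat}.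

Definition rV_coord (i : 'I_d) (x : 'rV[R]_d) : R := x ord0 i.

Let rV_set0 : g_sigma_preimage rV_coord set0.
Proof. exact: sigma_algebra0. Qed.

Let rV_setC A : g_sigma_preimage rV_coord A -> g_sigma_preimage rV_coord (~` A).
Proof. exact: sigma_algebraC. Qed.

Let rV_bigcup (F : (set 'rV[R]_d)^nat) :
  (forall i, g_sigma_preimage rV_coord (F i)) ->
  g_sigma_preimage rV_coord (\bigcup_i F i).
Proof. exact: sigma_algebra_bigcup. Qed.

(* The sigma-algebra generated by the coordinates, i.e. the Borel one. *)
HB.instance Definition _ := @isMeasurable.Build default_measure_display
  'rV[R]_d (g_sigma_preimage rV_coord) rV_set0 rV_setC rV_bigcup.

Lemma measurable_rV_coord i : measurable_fun setT (rV_coord i).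
Proof.
move=> _ Y mY; rewrite setTI; apply: sub_sigma_algebra => /=.
rewrite -bigcup_seq/=; exists i => /=; first by rewrite mem_index_enum.
by exists Y => //; rewrite setTI.
Qed.

Lemma measurable_fun_rVP d1 (T1 : measurableType d1) (f : T1 -> 'rV[R]_d) :
  (forall i, measurable_fun setT (rV_coord i \o f)) -> measurable_fun setT f.
Proof.
move=> mf _ A mA; rewrite setTI.
suff : g_sigma_preimage (fun i => rV_coord i \o f) `<=` measurable.
  apply; rewrite g_sigma_preimage_comp; exists A => //.
  by rewrite setTI.
apply: smallest_sub; first exact: sigma_algebra_measurable.
by apply: (big_ind (fun G => G `<=` measurable)) => //=[*|i _ B [C mC <-]];
  [rewrite subUset|exact: mf].
Qed.

End measurable_rV.

Section lebesgue_measure_rV.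
Context {R : realType}.

Definition rV_cons d (p : measurableTypeR R * 'rV[R]_d) : 'rV[R]_d.+1 :=
  \row_i if unlift ord0 i is Some j then p.2 ord0 j else p.1.

Lemma measurable_rV_cons d : measurable_fun setT (@rV_cons d).
Proof.
apply: measurable_fun_rVP => i.
case: (unliftP ord0 i) => [j ->|->].
- rewrite (_ : _ \o _ = rV_coord j \o snd); last first.
    by apply/funext => p /=; rewrite /rV_coord mxE liftK.
  by apply: measurableT_comp => //; exact: measurable_rV_coord.
- rewrite (_ : _ \o _ = fst) //.
  by apply/funext => p /=; rewrite /rV_coord mxE unlift_none.
Qed.

Definition rV_uncons d (x : 'rV[R]_d.+1) : measurableTypeR R * 'rV[R]_d :=
  (x ord0 ord0, \row_j x ord0 (lift ord0 j)).

Lemma measurable_rV_uncons d : measurable_fun setT (@rV_uncons d).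
Proof.
apply: measurable_fun_pair; first exact: (measurable_rV_coord ord0).
apply: measurable_fun_rVP => i.
rewrite (_ : _ \o _ = rV_coord (lift ord0 i)); first exact: measurable_rV_coord.
by apply/funext => x /=; rewrite /rV_coord mxE.
Qed.

Lemma rV_consK d : cancel (@rV_cons d) (@rV_uncons d).
Proof.
move=> [a v]; rewrite /rV_uncons mxE unlift_none; congr pair.
by apply/rowP => j; rewrite !mxE liftK.
Qed.

Section step.
Context {d : nat} (mu : {sigma_finite_measure set 'rV[R]_d -> \bar R}).

Definition lebesgue_rV_step : set 'rV[R]_d.+1 -> \bar R :=
  pushforward (lebesgue_measure \x mu)%E (@rV_cons d).

Let step0 : lebesgue_rV_step set0 = 0%E.
Proof. by rewrite /lebesgue_rV_step /pushforward preimage_set0 measure0. Qed.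

Let step_ge0 A : (0 <= lebesgue_rV_step A)%E.
Proof. by rewrite /lebesgue_rV_step /pushforward; exact: measure_ge0. Qed.

Let step_sigma_additive : semi_sigma_additive lebesgue_rV_step.
Proof.
move=> F mF tF mUF; rewrite /lebesgue_rV_step /pushforward preimage_bigcup.
have mcons A : measurable A -> measurable (@rV_cons d @^-1` A).
  by move=> mA; rewrite -[X in measurable X]setTI; exact: measurable_rV_cons.
apply: measure_semi_sigma_additive.
- by move=> n; exact: mcons.
- apply/trivIsetP => /= i j _ _ ij; rewrite -preimage_setI.
  by move/trivIsetP : tF => /(_ _ _ _ _ ij) ->//; rewrite preimage_set0.
- by rewrite -preimage_bigcup; exact: mcons.
Qed.

HB.instance Definition _ := isMeasure.Build _ _ _ lebesgue_rV_step
  step0 step_ge0 step_sigma_additive.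

Let step_sigma_finite : sigma_finite setT lebesgue_rV_step.
Proof.
have /sigma_finiteP[F [TF ndF Foo]] := sigma_finiteT (@lebesgue_measure R).
have /sigma_finiteP[G [TG ndG Goo]] := sigma_finiteT mu.
exists (fun n => @rV_uncons d @^-1` (F n `*` G n)).
  rewrite -preimage_bigcup; apply/esym/seteqP; split => // x _.
  have [n _ Fn] : (\bigcup_n F n) (rV_uncons x).1 by rewrite -TF.
  have [k _ Gk] : (\bigcup_n G n) (rV_uncons x).2 by rewrite -TG.
  exists (maxn n k) => //; split.
  - by move: Fn; exact/subsetPset/ndF/leq_maxl.
  - by move: Gk; exact/subsetPset/ndG/leq_maxr.
move=> k; have [mF Fk] := Foo k; have [mG Gk] := Goo k; split.
  rewrite -[X in measurable X]setTI; apply: measurable_rV_uncons => //.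
  exact: measurableX.
rewrite /lebesgue_rV_step /pushforward -comp_preimage.
rewrite (_ : _ \o _ = id); last exact/funext/rV_consK.
by rewrite preimage_id product_measure1E // lte_mul_pinfty // ge0_fin_numE.
Qed.

HB.instance Definition _ := Measure_isSigmaFinite.Build _ _ _ lebesgue_rV_step
  step_sigma_finite.

End step.

Fixpoint lebesgue_rV d : {sigma_finite_measure set 'rV[R]_d -> \bar R} :=
  match d with
  | 0 => \d_(0 : 'rV[R]_0)
  | d'.+1 => lebesgue_rV_step (lebesgue_rV d')
  end.

Lemma lebesgue_rV_box d (I : 'I_d -> set R) : (forall i, measurable (I i)) ->
  lebesgue_rV d [set x | forall i, I i (x ord0 i)] =
  (\prod_(i < d) lebesgue_measure (I i))%E.
Proof.
elim: d I => [|d IH] I mI.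
  by rewrite big_ord0 /= diracE mem_set //= => -[].
rewrite big_ord_recl -IH //= /lebesgue_rV_step /pushforward.
have -> : @rV_cons d @^-1` [set x | forall i, I i (x ord0 i)] = I ord0 `*`
    [set x : 'rV[R]_d | forall i : 'I_d, I (lift ord0 i) (x ord0 i)].
  apply/seteqP; split => -[a v] /=.
    move=> H; split; first by have := H ord0; rewrite mxE unlift_none.
    by move=> i; have := H (lift ord0 i); rewrite mxE liftK.
  by move=> [Ia Iv] i; rewrite mxE; case: unliftP => [j ->|->].
rewrite product_measure1E //; first exact: mI.
rewrite (_ : [set x | _] =
  \bigcap_(i in [set: 'I_d]) (rV_coord i @^-1` I (lift ord0 i))).
  apply: fin_bigcap_measurable => // i _; rewrite -[X in measurable X]setTI.
  by apply: measurable_rV_coord => //; exact: mI.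
by apply/seteqP; split => x /= H i; [move=> _|]; exact: H.
Qed.

End lebesgue_measure_rV.

Section matrix_notions.
Context {R : realType}.

Definition posdef n (A : 'M[R]_n) :=
  forall x : 'cV[R]_n, x != 0 -> 0 < (x^T *m A *m x) 0 0.

Definition spd n (A : 'M[R]_n) := A^T = A /\ posdef A.

Definition loewner_le n (A B : 'M[R]_n) :=
  forall x : 'cV[R]_n, (x^T *m A *m x) 0 0 <= (x^T *m B *m x) 0 0.

(* For symmetric matrices of positive size, the set of (real) eigenvalues is
   finite and nonempty, so that sup and inf are a maximum and a minimum. *)
Definition lambda_max n (A : 'M[R]_n) : R := sup [set a | eigenvalue A a].
Definition lambda_min n (A : 'M[R]_n) : R := inf [set a | eigenvalue A a].

Definition sigma_max n (B : 'M[R]_n) : R := Num.sqrt (lambda_max (B^T *m B)).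

Definition sym_part n (B : 'M[R]_n) : 'M[R]_n := 2^-1 *: (B + B^T).

Definition cond_tilde n (B : 'M[R]_n) : R :=
  sigma_max B / lambda_min (sym_part B).

(* P^{-1/2}: the (unique) symmetric positive definite square root of P^{-1}. *)
Definition mx_invsqrt n (P : 'M[R]_n) : 'M[R]_n :=
  xget 0 [set Q | spd Q /\ Q *m Q = invmx P].

End matrix_notions.

Section finite_elements.
Context {R : realType} {d : nat}.
Implicit Types (Omega : set 'rV[R]_d).

Definition vhull nv (vert : 'I_nv -> 'rV[R]_d) (e : {set 'I_nv}) : set 'rV[R]_d :=
  [set x | exists c : 'I_nv -> R,
    [/\ forall i, 0 <= c i, forall i, i \notin e -> c i = 0,
        \sum_i c i = 1 & x = \sum_i c i *: vert i]].

Definition affinely_independent nv (vert : 'I_nv -> 'rV[R]_d) (e : {set 'I_nv}) :=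
  forall c : 'I_nv -> R, (forall i, i \notin e -> c i = 0) ->
    \sum_i c i = 0 -> \sum_i c i *: vert i = 0 -> forall i, c i = 0.

Definition bounded_domain Omega :=
  [/\ open Omega, connected Omega, bounded_set Omega & Omega !=set0].

(* elts lists the vertex sets of the elements. The last two clauses express both
   that Omega is polyhedral and that the mesh fits it: its closure is the union
   of the elements and its boundary is a union of (d-1)-dimensional faces. *)
Definition simplicial_mesh Omega nv (vert : 'I_nv -> 'rV[R]_d)
    (elts : {set {set 'I_nv}}) :=
  [/\ forall e, e \in elts -> #|e| = d.+1 /\ affinely_independent vert e,
      forall e f, e \in elts -> f \in elts ->
        vhull vert e `&` vhull vert f = vhull vert (e :&: f),
      forall i, exists2 e, e \in elts & i \in e,
      closure Omega = \bigcup_(e in [set` elts]) vhull vert e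
    & exists2 faces : {set {set 'I_nv}},
        forall f, f \in faces ->
          #|f| = d /\ exists2 e, e \in elts & f \subset e
      & closure Omega `\` Omega = \bigcup_(f in [set` faces]) vhull vert f].

Definition interior_numbering Omega nv (vert : 'I_nv -> 'rV[R]_d)
    N (iv : 'I_N -> 'I_nv) :=
  injective iv /\ forall i, Omega (vert i) <-> exists k, iv k = i.

Definition affine_on (K : set 'rV[R]_d) (f : 'rV[R]_d -> R) :=
  exists (a : 'cV[R]_d) (b : R), forall x, K x -> f x = (x *m a) 0 0 + b.

Definition nodal_basis Omega nv (vert : 'I_nv -> 'rV[R]_d)
    (elts : {set {set 'I_nv}}) N (iv : 'I_N -> 'I_nv)
    (phi : 'I_N -> 'rV[R]_d -> R) :=
  forall k,
    [/\ {within closure Omega, continuous (phi k)},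
        forall e, e \in elts -> affine_on (vhull vert e) (phi k)
      & forall i, phi k (vert i) = (i == iv k)%:R].

Definition diffusion Omega (D : 'rV[R]_d -> 'M[R]_d) (dmin dmax : R) :=
  [/\ 0 < dmin, 0 < dmax,
      forall i j, measurable_fun Omega (fun x => D x i j)
    & forall x, Omega x -> [/\ (D x)^T = D x,
        loewner_le dmin%:M (D x) & loewner_le (D x) dmax%:M]].

(* For a piecewise linear f this is the gradient in the interior of the elements;
   its unspecified values on the faces, a null set, do not affect integrals. *)
Definition grad (f : 'rV[R]_d -> R) (x : 'rV[R]_d) : 'rV[R]_d :=
  \row_i 'D_(delta_mx ord0 i) f x.

Definition mass_matrix Omega N (phi : 'I_N -> 'rV[R]_d -> R) : 'M[R]_N :=
  \matrix_(k, j) Rintegral (lebesgue_rV d) Omega (fun x => phi k x * phi j x).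

Definition stiffness_matrix Omega (D : 'rV[R]_d -> 'M[R]_d)
    N (phi : 'I_N -> 'rV[R]_d -> R) : 'M[R]_N :=
  \matrix_(k, j) Rintegral (lebesgue_rV d) Omega
    (fun x => (grad (phi k) x *m D x *m (grad (phi j) x)^T) 0 0).

End finite_elements.

Section real_jordan.
Context {R : realType}.

(* A block with m.+1 diagonal entries, resp. m.+1 diagonal 2x2 blocks. *)
Inductive jordan_block :=
  | RealBlock (mu : R) (m : nat)
  | CplxBlock (alpha beta : R) (m : nat).

Definition rot_mx (alpha beta : R) : 'M[R]_2 :=
  \matrix_(i, j) if i == j then alpha else if i == 0 then beta else - beta.

Definition jb_len b : nat :=
  match b with RealBlock _ m | CplxBlock _ _ m => m.+1 end.

Definition jb_dim b : nat :=
  match b with RealBlock _ _ => 1%N | CplxBlock _ _ _ => 2%N end.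

Definition jb_core b : 'M[R]_(jb_dim b) :=
  match b with
  | RealBlock mu _ => mu%:M
  | CplxBlock alpha beta _ => rot_mx alpha beta
  end.

Definition shift_mx m : 'M[R]_m := \matrix_(i, j) (j == i.+1 :> nat)%:R.

(* Block upper bidiagonal, with jb_core b on the block diagonal and the identity
   of size jb_dim b on the block superdiagonal. *)
Definition jb_mx b : 'M[R]_(jb_len b * jb_dim b) :=
  1%:M *t jb_core b + shift_mx (jb_len b) *t 1%:M.

Definition jordan_mx p (B : 'I_p -> jordan_block) s
    (hs : (\sum_(q < p) jb_len (B q) * jb_dim (B q))%N = s) : 'M[R]_s :=
  castmx (hs, hs) (\mxdiag_(q < p) jb_mx (B q)).

Definition real_jordan_form s (Gamma T : 'M[R]_s) p (B : 'I_p -> jordan_block)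
    (hs : (\sum_(q < p) jb_len (B q) * jb_dim (B q))%N = s) :=
  [/\ T \in unitmx,
      forall q alpha beta m, B q = CplxBlock alpha beta m -> beta != 0
    & Gamma = T *m jordan_mx hs *m invmx T].

(* Row of the Jordan matrix at component c of the i-th diagonal block of J_q. *)
Definition jordan_index p (B : 'I_p -> jordan_block) s
    (hs : (\sum_(q < p) jb_len (B q) * jb_dim (B q))%N = s)
    (q : 'I_p) (i : 'I_(jb_len (B q))) (c : 'I_(jb_dim (B q))) : 'I_s :=
  cast_ord hs (tagnat.Rank (p_ := fun q => (jb_len (B q) * jb_dim (B q))%N)
                 q (mxtens_index (i, c))).

End real_jordan.
Arguments jordan_block : clear implicits.

Section stage_system.
Context {R : realType} {N : nat}.
Variables (M A : 'M[R]_N) (dt : R).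

Definition real_coef (mu : R) : 'M[R]_N := M + (mu * dt) *: A.

Definition cplx_coef (alpha beta : R) : 'M[R]_(2 * N) :=
  1%:M *t M + dt *: (rot_mx alpha beta *t A).

Definition stage_system s (Gamma : 'M[R]_s) (u : 'cV[R]_N)
    (v : 'I_s -> 'cV[R]_N) :=
  forall k, M *m v k + dt *: (A *m \sum_j Gamma k j *: v j) = - (A *m u).

Definition stage_mx s (Gamma : 'M[R]_s) : 'M[R]_(s * N) :=
  1%:M *t M + dt *: (Gamma *t A).

Definition transformed_stage_mx s (Gamma T : 'M[R]_s) : 'M[R]_(s * N) :=
  (invmx T *t 1%:M) *m stage_mx Gamma *m (T *t 1%:M).

Definition stack r (v : 'I_r -> 'cV[R]_N) : 'cV[R]_(r * N) :=
  \col_k v (mxtens_unindex k).1 (mxtens_unindex k).2 0.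

Definition next_or_0 m r (w : 'I_m -> 'I_r -> 'cV[R]_N) (i : 'I_m) :
    'I_r -> 'cV[R]_N :=
  if insub i.+1 is Some i' then w i' else fun=> 0.

(* The smaller systems attached to a Jordan block, solved from the last one up:
   the unknown of the i-th system is w i, and w (i + 1) is already known. *)
Definition block_substitution (b : jordan_block R) :
    ('I_(jb_len b) -> 'I_(jb_dim b) -> 'cV[R]_N) ->
    ('I_(jb_len b) -> 'I_(jb_dim b) -> 'cV[R]_N) -> Prop :=
  match b with
  | RealBlock mu m => fun g w => forall i : 'I_m.+1,
      real_coef mu *m w i ord0 = g i ord0 - dt *: (A *m next_or_0 w i ord0)
  | CplxBlock alpha beta m => fun g w => forall i : 'I_m.+1,
      cplx_coef alpha beta *m stack (w i) =
      stack (g i) - dt *: ((1%:M *t A) *m stack (next_or_0 w i))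
  end.

(* w = (T^{-1} (x) I) v are the transformed stages and g the transformed
   right-hand side. *)
Definition jordan_substitution s (T : 'M[R]_s) p (B : 'I_p -> jordan_block R)
    (hs : (\sum_(q < p) jb_len (B q) * jb_dim (B q))%N = s)
    (u : 'cV[R]_N) (v : 'I_s -> 'cV[R]_N) :=
  let w k := \sum_j invmx T k j *: v j in
  let g k := \sum_j invmx T k j *: - (A *m u) in
  forall q : 'I_p, @block_substitution (B q)
    (fun i c => g (jordan_index hs i c)) (fun i c => w (jordan_index hs i c)).

(* The diagonal blocks of the transformed stage matrix in the partition given by
   the diagonal blocks of the Jordan matrix, i.e. the coefficient matrices of the
   linear systems met in block back substitution. *)
Definition pivot_block s (Gamma T : 'M[R]_s) p (B : 'I_p -> jordan_block R)
    (hs : (\sum_(q < p) jb_len (B q) * jb_dim (B q))%N = s)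
    (q : 'I_p) (i : 'I_(jb_len (B q))) : 'M[R]_(jb_dim (B q) * N) :=
  let idx (k : 'I_(jb_dim (B q) * N)) :=
    mxtens_index (jordan_index hs i (mxtens_unindex k).1,
                  (mxtens_unindex k).2) in
  mxsub idx idx (transformed_stage_mx Gamma T).

(* The conditioning of the integration: the largest condition number among the
   linear systems that are solved. *)
Definition rk_conditioning s (Gamma T : 'M[R]_s) p (B : 'I_p -> jordan_block R)
    (hs : (\sum_(q < p) jb_len (B q) * jb_dim (B q))%N = s) : R :=
  \big[Num.max/0]_(q < p) \big[Num.max/0]_(i < jb_len (B q))
    cond_tilde (pivot_block Gamma T hs i).

Definition block_cond (b : jordan_block R) : R :=
  match b with
  | RealBlock mu _ => cond_tilde (real_coef mu)
  | CplxBlock alpha beta _ => cond_tilde (cplx_coef alpha beta)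
  end.

End stage_system.

(* Main.v *)
Require Import Defs.
From HB Require Import structures.
From mathcomp Require Import all_boot all_order all_algebra.
From mathcomp Require Import all_classical all_reals all_analysis.
From mathcomp Require Import complex mxtens measurable_realfun ring lra.

(* T^-1 (x) I block-triangularises the stage matrix, and the linear systems
   met in block back substitution are I (x) M + dt C (x) A, where C is the
   1x1 or 2x2 core of a Jordan block; the eigenvalues of the block are those
   of C, because I (x) C commutes with the nilpotent matrix (shift) (x) I.
   For the 2x2 core, C^T C = (alpha^2 + beta^2) I and (C + C^T) / 2 =
   alpha I. The first identity and the triangle inequality bound the largest
   singular value of I (x) M + dt C (x) A by
   lambda_max M + dt sqrt(alpha^2 + beta^2) lambda_max A, and the second one
   turns its symmetric part into I (x) (M + dt alpha A).

   M and A are integrals of positive semidefinite matrices, and M is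
   definite since a nonzero continuous function has a positive integral of
   its square. The delicate point is that the gradients have to be bounded
   and measurable on all of Omega, faces included: every ray meets each of
   the finitely many elements in an interval, hence stays in one of them
   near its origin. One-sided directional derivatives thus exist everywhere,
   are bounded, and are limits of measurable difference quotients. *)

Import Order.TTheory GRing.Theory Num.Theory.
Import numFieldNormedType.Exports.

Local Open Scope classical_set_scope.
Local Open Scope complex_scope.
Local Open Scope ring_scope.

Set Implicit Arguments.
Unset Strict Implicit.

(** * Bilinear and quadratic forms *)

Section bilinear_forms.
Context {R : comNzRingType}.
Implicit Types (n : nat) (a : R).

Definition bform n (S : 'M[R]_n) (x y : 'cV[R]_n) : R := (x^T *m S *m y) 0 0.

Definition qform n (S : 'M[R]_n) (x : 'cV[R]_n) : R := (x^T *m S *m x) 0 0.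

Lemma qform_bform n (S : 'M[R]_n) x : qform S x = bform S x x.
Proof. by []. Qed.

Lemma bformDl n (S : 'M[R]_n) x y z :
  bform S (x + y) z = bform S x z + bform S y z.
Proof. by rewrite /bform linearD/= !mulmxDl mxE. Qed.

Lemma bformDr n (S : 'M[R]_n) x y z :
  bform S x (y + z) = bform S x y + bform S x z.
Proof. by rewrite /bform mulmxDr mxE. Qed.

Lemma bformZl n (S : 'M[R]_n) a x y : bform S (a *: x) y = a * bform S x y.
Proof. by rewrite /bform linearZ/= -!scalemxAl mxE. Qed.

Lemma bformZr n (S : 'M[R]_n) a x y : bform S x (a *: y) = a * bform S x y.
Proof. by rewrite /bform -scalemxAr mxE. Qed.

Lemma bformC n (S : 'M[R]_n) x y : S^T = S -> bform S x y = bform S y x.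
Proof.
move=> Ssym; transitivity ((x^T *m S *m y)^T 0 0); first by rewrite mxE.
by rewrite !trmx_mul trmxK Ssym mulmxA.
Qed.

Lemma bform_delta n (S : 'M[R]_n) i j :
  bform S (delta_mx i 0) (delta_mx j 0) = S i j.
Proof. by rewrite /bform trmx_delta -rowE -colE !mxE. Qed.

Lemma qform0 n (S : 'M[R]_n) : qform S 0 = 0.
Proof. by rewrite /qform mulmx0 mxE. Qed.

Lemma qformD n (S S' : 'M[R]_n) x : qform (S + S') x = qform S x + qform S' x.
Proof. by rewrite /qform mulmxDr mulmxDl mxE. Qed.

Lemma qformZ n a (S : 'M[R]_n) x : qform (a *: S) x = a * qform S x.
Proof. by rewrite /qform -scalemxAr -scalemxAl mxE. Qed.

Lemma qformN n (S : 'M[R]_n) x : qform (- S) x = - qform S x.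
Proof. by rewrite -scaleN1r qformZ mulN1r. Qed.

Lemma qform_scalar n a (x : 'cV[R]_n) : qform a%:M x = a * qform 1%:M x.
Proof. by rewrite -[a%:M]scalemx1 qformZ. Qed.

Lemma qform_congr n m (Q : 'M[R]_(m, n)) (S : 'M[R]_m) x :
  qform (Q^T *m S *m Q) x = qform S (Q *m x).
Proof. by rewrite /qform trmx_mul !mulmxA. Qed.

Lemma qform_gram n m (Q : 'M[R]_(m, n)) x :
  qform (Q^T *m Q) x = qform 1%:M (Q *m x).
Proof. by rewrite -qform_congr mulmx1. Qed.

Lemma qform_sum n (S : 'M[R]_n) x :
  qform S x = \sum_k \sum_j x k 0 * x j 0 * S k j.
Proof.
rewrite /qform mxE exchange_big; apply: eq_bigr => j _.
by rewrite mxE big_distrl; apply: eq_bigr => k _; rewrite mxE/=; ring.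
Qed.

Lemma qform_diag n (l : 'rV[R]_n) x :
  qform (diag_mx l) x = \sum_i l 0 i * x i 0 ^+ 2.
Proof.
rewrite /qform mul_mx_diag mxE; apply: eq_bigr => i _.
by rewrite !mxE; ring.
Qed.

Lemma qform1E n (x : 'cV[R]_n) : qform 1%:M x = \sum_i x i 0 ^+ 2.
Proof.
by rewrite -diag_const_mx qform_diag; apply: eq_bigr => i _; rewrite mxE mul1r.
Qed.

Lemma qformDr n (S : 'M[R]_n) x y : S^T = S ->
  qform S (x + y) = qform S x + 2 * bform S x y + qform S y.
Proof.
move=> Ssym; rewrite !qform_bform bformDl !bformDr (bformC y x Ssym); ring.
Qed.

End bilinear_forms.

Section semidefinite.
Context {R : rcfType}.
Implicit Types n : nat.

Definition psd n (S : 'M[R]_n) := S^T = S /\ forall x, 0 <= qform S x.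

Lemma psdZ n a (S : 'M[R]_n) : 0 <= a -> psd S -> psd (a *: S).
Proof.
move=> a0 [Ssym S0]; split; first by rewrite linearZ/= Ssym.
by move=> x; rewrite qformZ mulr_ge0.
Qed.

Lemma psd_congr n m (Q : 'M[R]_(m, n)) (S : 'M[R]_m) :
  psd S -> psd (Q^T *m S *m Q).
Proof.
move=> [Ssym S0]; split; first by rewrite !trmx_mul trmxK Ssym mulmxA.
by move=> x; rewrite qform_congr.
Qed.

Lemma psd1 n : psd (1%:M : 'M[R]_n).
Proof.
split; first exact: trmx1.
by move=> x; rewrite qform1E sumr_ge0// => i _; exact: sqr_ge0.
Qed.

Lemma psd_CauchySchwarz n (S : 'M[R]_n) x y : psd S ->
  bform S x y ^+ 2 <= qform S x * qform S y.
Proof.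
move=> [Ssym S0].
pose P := \poly_(i < 3) [:: qform S y; 2 * bform S x y; qform S x]`_i.
suff /deg_le2_poly_ge0 : forall t, 0 <= P.[t].
  by move=> /(_ (size_poly _ _)); rewrite !coef_poly/=; nra.
move=> t; have := S0 (t *: x + y).
rewrite (qformDr _ _ Ssym) /P horner_poly !big_ord_recr big_ord0/=.
by rewrite (qform_bform S (t *: x)) !bformZl !bformZr -qform_bform; lra.
Qed.

Definition l2norm n (x : 'cV[R]_n) : R := Num.sqrt (qform 1%:M x).

Lemma l2norm_ge0 n (x : 'cV[R]_n) : 0 <= l2norm x.
Proof. exact: sqrtr_ge0. Qed.

Lemma sqr_l2norm n (x : 'cV[R]_n) : l2norm x ^+ 2 = qform 1%:M x.
Proof. by rewrite sqr_sqrtr//; have [_] := psd1 n; apply. Qed.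

Lemma l2norm_eq0 n (x : 'cV[R]_n) : (l2norm x == 0) = (x == 0).
Proof.
rewrite -sqrf_eq0 sqr_l2norm qform1E psumr_eq0 => [|i _]; last exact: sqr_ge0.
apply/allP/eqP => [x0|-> i _]; last by rewrite /= mxE expr0n.
apply/colP => i; apply/eqP; rewrite mxE -sqrf_eq0.
exact: x0 (mem_index_enum i).
Qed.

Lemma qform1_gt0 n (x : 'cV[R]_n) : x != 0 -> 0 < qform 1%:M x.
Proof. by move=> x0; rewrite -sqr_l2norm exprn_even_gt0//= l2norm_eq0. Qed.

Lemma l2norm_le_scale n m (x : 'cV[R]_n) (y : 'cV[R]_m) c : 0 <= c ->
  (l2norm x <= c * l2norm y) = (qform 1%:M x <= c ^+ 2 * qform 1%:M y).
Proof.
move=> c0; rewrite -ler_sqr ?nnegrE ?mulr_ge0 ?l2norm_ge0//.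
by rewrite exprMn !sqr_l2norm.
Qed.

Lemma l2normZ n a (x : 'cV[R]_n) : l2norm (a *: x) = `|a| * l2norm x.
Proof.
rewrite /l2norm qform_bform bformZl bformZr -qform_bform mulrA -expr2.
by rewrite sqrtrM ?sqr_ge0// sqrtr_sqr.
Qed.

Lemma ler_l2normD n (x y : 'cV[R]_n) : l2norm (x + y) <= l2norm x + l2norm y.
Proof.
rewrite -ler_sqr ?nnegrE ?addr_ge0 ?l2norm_ge0// sqrrD !sqr_l2norm.
rewrite qformDr ?trmx1// lerD2r lerD2l -[leRHS]mulr_natl ler_pM2l//.
rewrite (le_trans (ler_norm _))// -ler_sqr ?nnegrE ?mulr_ge0 ?l2norm_ge0//.
rewrite real_normK ?num_real// exprMn !sqr_l2norm.
exact/psd_CauchySchwarz/psd1.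
Qed.

End semidefinite.

Section definite.
Context {R : realType}.
Implicit Types n : nat.

Lemma spd_psd n (S : 'M[R]_n) : spd S -> psd S.
Proof.
move=> [Ssym S0]; split => // x; have [->|x0] := eqVneq x 0.
  by rewrite qform0.
exact/ltW/S0.
Qed.

Lemma spdD_psd n (S S' : 'M[R]_n) : spd S -> psd S' -> spd (S + S').
Proof.
move=> [Ssym S0] [S'sym S'0]; split; first by rewrite linearD/= Ssym S'sym.
by move=> x x0; rewrite -/(qform _ x) qformD ltr_pwDl//; exact: S0.
Qed.

Lemma spd_unitmx n (S : 'M[R]_n) : spd S -> S \in unitmx.
Proof.
move=> [Ssym S0]; rewrite -row_free_unit -kermx_eq0; apply: contraT.
move=> /rowV0Pn[v /sub_kermxP vS v0].
by have := S0 v^T; rewrite trmxK vS mul0mx mxE ltxx trmx_eq0 => /(_ v0).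
Qed.

Lemma spd_congr n (Q S : 'M[R]_n) :
  Q \in unitmx -> spd S -> spd (Q^T *m S *m Q).
Proof.
move=> Qu [Ssym S0]; split; first by rewrite !trmx_mul trmxK Ssym mulmxA.
move=> x x0; rewrite -/(qform _ x) qform_congr; apply: S0.
by apply: contraNN x0 => /eqP Qx; rewrite -(mulKmx Qu x) Qx mulmx0.
Qed.

Lemma psd_loewner_coef_le n (S : 'M[R]_n) a i j : psd S -> loewner_le S a%:M ->
  `|S i j| <= a.
Proof.
move=> Spsd Sa; have diag_le k : S k k <= a.
  have := Sa (delta_mx k 0); rewrite -!/(qform _ _) !qform_bform !bform_delta.
  by rewrite mxE eqxx.
have diag_ge0 k : 0 <= S k k.
  by rewrite -bform_delta -qform_bform; have [_] := Spsd; apply.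
have a0 := le_trans (diag_ge0 i) (diag_le i).
rewrite -ler_sqr ?nnegrE// real_normK ?num_real// -bform_delta.
apply: le_trans (psd_CauchySchwarz _ _ Spsd) _.
by rewrite !qform_bform !bform_delta expr2 ler_pM.
Qed.

End definite.

(** * Eigenvalues *)

Section eigenvalues.
Context {F : fieldType}.
Implicit Types n : nat.

Lemma eigenvalue_unitmx n (A : 'M[F]_n) a :
  eigenvalue A a = (A - a%:M \notin unitmx).
Proof. by rewrite -row_free_unit -kermx_eq0. Qed.

Lemma eigenvalueN n (A : 'M[F]_n) a : eigenvalue (- A) a = eigenvalue A (- a).
Proof.
rewrite !eigenvalue_unitmx; have -> : - A - a%:M = -1 *: (A - (- a)%:M).
  by rewrite raddfN/= opprK scaleN1r opprD.
by rewrite unitmxZ// rpredN unitr1.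
Qed.

Lemma eigenvalue_diag n (l : 'rV[F]_n) a :
  eigenvalue (diag_mx l) a = [exists i, l 0 i == a].
Proof.
rewrite eigenvalue_unitmx -diag_const_mx -linearB/= unitmxE unitfE negbK.
rewrite det_diag.
by apply/prodf_eq0/existsP => -[k]; rewrite ?mxE ?subr_eq0 => ?; exists k;
  rewrite // !mxE subr_eq0.
Qed.

Lemma eigenvalue_conj n (P J : 'M[F]_n) a : P \in unitmx ->
  eigenvalue (P *m J *m invmx P) a = eigenvalue J a.
Proof.
move=> Pu; rewrite !eigenvalue_unitmx.
have -> : P *m J *m invmx P - a%:M = P *m (J - a%:M) *m invmx P.
  by rewrite mulmxBr mulmxBl mul_mx_scalar -scalemxAl mulmxV// scalemx1.
by rewrite !unitmx_mul unitmx_inv Pu andbT.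
Qed.

Lemma eigenvalue_scalar n a b : (0 < n)%N ->
  eigenvalue (a%:M : 'M[F]_n) b = (a == b).
Proof.
move=> n0; rewrite -diag_const_mx eigenvalue_diag.
by apply/existsP/idP => [[k]|ab]; last exists (Ordinal n0); rewrite mxE.
Qed.

Lemma det_mxdiag p (p_ : 'I_p -> nat) (D : forall q, 'M[F]_(p_ q)) :
  \det (\mxdiag_q D q) = \prod_q \det (D q).
Proof.
elim: p p_ D => [|p IH] p_ D.
  rewrite [RHS]big_ord0; move: (\mxdiag__ _).
  by rewrite [(\sum_i p_ i)%N]big_ord0 => ?; exact: det_mx00.
rewrite mxdiag_recl [RHS]big_ord_recl -IH.
by case: _ / mxsize_recl; rewrite castmx_id det_ublock.
Qed.

Lemma eigenvalue_mxdiag p (p_ : 'I_p -> nat) (D : forall q, 'M[F]_(p_ q)) a :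
  eigenvalue (\mxdiag_q D q) a = [exists q, eigenvalue (D q) a].
Proof.
rewrite eigenvalue_unitmx -mxdiagZ -mxdiagB unitmxE unitfE negbK det_mxdiag.
by apply/prodf_eq0/existsP => -[q Dq]; exists q => //; move: Dq;
  rewrite eigenvalue_unitmx unitmxE unitfE negbK.
Qed.

End eigenvalues.

Section spectral_theorem.
Context {R : rcfType}.
Implicit Types n : nat.

Lemma sym_eigenvalue_exists n (S : 'M[R]_n) : (0 < n)%N -> S^T = S ->
  exists a, eigenvalue S a.
Proof.
move=> n0 Ssym; pose SC := map_mx (real_complex R) S; pose i0 := Ordinal n0.
have SC_herm : SC \is hermsymmx.
  apply: realsym_hermsym.
    by apply/is_hermitianmxP; rewrite expr0 scale1r map_mx_id// map_trmx Ssym.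
  by apply/mxOverP => i j; apply/complex_realP; exists (S i j); rewrite mxE.
have /mxOverP/(_ 0 i0)/complex_realP[a aE] :=
  hermitian_spectral_diag_real SC_herm.
exists a; rewrite -(eigenvalue_map (real_complex R)) -/SC.
have /hermitian_normalmx/orthomx_spectralP -> := SC_herm.
set P := spectralmx SC; have Pu : P \in unitmx by exact: spectral_unit.
rewrite -[X in _ *m _ *m X]invmxK eigenvalue_conj ?unitmx_inv// eigenvalue_diag.
by apply/existsP; exists i0; rewrite aE.
Qed.

Lemma sym_unit_eigenvector n (S : 'M[R]_n) a : S^T = S -> eigenvalue S a ->
  exists2 v : 'cV[R]_n, qform 1%:M v = 1 & S *m v = a *: v.
Proof.
move=> Ssym /eigenvalueP[u uS u0].
have ut0 : l2norm u^T != 0 by rewrite l2norm_eq0 trmx_eq0.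
exists ((l2norm u^T)^-1 *: u^T).
  rewrite -sqr_l2norm l2normZ ger0_norm ?invr_ge0 ?l2norm_ge0//.
  by rewrite mulVf ?expr1n.
by rewrite -scalemxAr -[in LHS]Ssym -trmx_mul uS linearZ/= !scalerA mulrC.
Qed.

Lemma eigenvalue_qform n (S : 'M[R]_n) a : S^T = S -> eigenvalue S a ->
  exists2 v : 'cV[R]_n, qform 1%:M v = 1 & qform S v = a.
Proof.
move=> Ssym /(sym_unit_eigenvector Ssym)[v v1 Sv]; exists v => //.
by rewrite -[RHS]mulr1 -v1 /qform mulmx1 -mulmxA Sv -scalemxAr mxE.
Qed.

(* For w = 0 this is the identity, since 2 / 0 = 0. *)
Definition reflection n (w : 'cV[R]_n) : 'M[R]_n :=
  1%:M - (2 / qform 1%:M w) *: (w *m w^T).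

Lemma reflection_sym n (w : 'cV[R]_n) : (reflection w)^T = reflection w.
Proof. by rewrite linearB linearZ/= trmx1 trmx_mul trmxK. Qed.

Lemma mul_reflection n (w x : 'cV[R]_n) :
  reflection w *m x = x - (2 * bform 1%:M w x / qform 1%:M w) *: w.
Proof.
rewrite mulmxBl mul1mx -scalemxAl -mulmxA [w^T *m x]mx11_scalar mul_mx_scalar.
by rewrite scalerA /bform mulmx1 mulrAC.
Qed.

Lemma reflection_self n (w : 'cV[R]_n) : reflection w *m w = - w.
Proof.
have [->|w0] := eqVneq w 0; first by rewrite mulmx0 oppr0.
rewrite mul_reflection -qform_bform mulfK ?gt_eqF ?qform1_gt0//.
by rewrite -{1}[w]scale1r -scalerBl (_ : 1 - 2 = -1) ?scaleN1r//; ring.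
Qed.

Lemma reflectionK n (w : 'cV[R]_n) : reflection w *m reflection w = 1%:M.
Proof.
rewrite {2}/reflection mulmxBr mulmx1 -scalemxAr mulmxA reflection_self.
by rewrite mulNmx scalerN opprK subrK.
Qed.

Lemma reflection_sub n (x y : 'cV[R]_n) : qform 1%:M x = qform 1%:M y ->
  reflection (x - y) *m x = y.
Proof.
move=> xy; rewrite mul_reflection; have [/subr0_eq ->|w0] := eqVneq (x - y) 0.
  by rewrite subrr scaler0 subr0.
have -> : 2 * bform 1%:M (x - y) x = qform 1%:M (x - y).
  move: xy; rewrite qformDr ?trmx1// bformDl -scaleN1r !qform_bform.
  by rewrite !(bformZl, bformZr) (bformC y x) ?trmx1// => <-; ring.
by rewrite divff ?gt_eqF ?qform1_gt0// scale1r opprB addrC subrK.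
Qed.

Definition spectral_decomp n (S U : 'M[R]_n) (l : 'rV[R]_n) :=
  U *m U^T = 1%:M /\ S = U^T *m diag_mx l *m U.

Lemma spectral_decomp_congr n (S U H : 'M[R]_n) l : H *m H^T = 1%:M ->
  spectral_decomp (H *m S *m H^T) U l -> spectral_decomp S (U *m H) l.
Proof.
move=> HH [UU HSE]; split.
  by rewrite trmx_mul -mulmxA (mulmxA H) HH mul1mx.
have HH' : H^T *m H = 1%:M by exact: mulmx1C.
rewrite trmx_mul !mulmxA -[H^T *m _ *m _]mulmxA -[_ *m (_ *m _) *m U]mulmxA.
by rewrite -HSE !mulmxA HH' mul1mx -mulmxA HH' mulmx1.
Qed.

Lemma spectral_decomp_block n (S U : 'M[R]_n) l a : spectral_decomp S U l ->
  @spectral_decomp (1 + n) (block_mx a%:M 0 0 S) (block_mx 1%:M 0 0 U)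
    (row_mx a%:M l).
Proof.
move=> [UU SE]; rewrite /spectral_decomp tr_block_mx diag_mx_row.
have -> : diag_mx a%:M = a%:M :> 'M[R]_1.
  by apply/matrixP => i j; rewrite !ord1 !mxE.
rewrite !mulmx_block !trmx0 trmx1.
rewrite !(mulmx0, mul0mx, addr0, add0r, mulmx1, mul1mx).
by rewrite UU -SE -scalar_mx_block.
Qed.

Lemma sym_eigenvector_block_mx n (S : 'M[R]_(1 + n)) a : S^T = S ->
  S *m delta_mx 0 0 = a *: (delta_mx 0 0 : 'cV_(1 + n)) ->
  S = block_mx a%:M 0 0 (drsubmx S).
Proof.
move=> Ssym /colP S0; have SE i : S i 0 = (i == 0)%:R * a.
  by have := S0 i; rewrite -colE !mxE andbT mulrC.
have dlsubmx0 : dlsubmx S = 0.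
  apply/colP => i; have -> : dlsubmx S i 0 = S (rshift 1 i) 0.
    by rewrite !mxE; congr (S _ _); exact: val_inj.
  by rewrite SE mxE mul0r.
rewrite -[LHS]submxK -[X in block_mx _ X _ _]trmxK trmx_ursub Ssym dlsubmx0.
rewrite trmx0; congr block_mx; apply/matrixP => i j; rewrite !ord1 !mxE.
by rewrite (_ : lshift n 0 = 0) ?SE ?mul1r ?mulr1n//; exact: val_inj.
Qed.

Lemma sym_spectral n (S : 'M[R]_n) : S^T = S ->
  exists U l, spectral_decomp S U l.
Proof.
elim: n S => [|n IH] S Ssym.
  exists 1%:M, 0; split; first by rewrite trmx1 mulmx1.
  by rewrite [LHS]flatmx0 [RHS]flatmx0.
have [a aS] := sym_eigenvalue_exists (ltn0Sn n) Ssym.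
have [v v1 Sv] := sym_unit_eigenvector Ssym aS.
pose e : 'cV[R]_n.+1 := delta_mx 0 0; pose H := reflection (e - v).
have Hsym : H^T = H by exact: reflection_sym.
have HH : H *m H^T = 1%:M by rewrite Hsym reflectionK.
have He : H *m e = v.
  by apply: reflection_sub; rewrite v1 qform_bform bform_delta mxE eqxx.
pose S' : 'M[R]_(1 + n) := H *m S *m H^T.
have S'sym : S'^T = S' by rewrite !trmx_mul trmxK Ssym mulmxA.
have S'e : S' *m e = a *: e.
  rewrite /S' Hsym -[LHS]mulmxA He -mulmxA Sv -scalemxAr -He mulmxA reflectionK.
  by rewrite mul1mx.
have S'E : S' = block_mx a%:M 0 0 (drsubmx S').
  exact: sym_eigenvector_block_mx.
have [|U [l Ul]] := IH (drsubmx S'); first by rewrite trmx_drsub S'sym.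
pose V : 'M[R]_(1 + n) := block_mx 1%:M 0 0 U.
exists (V *m H), (row_mx a%:M l); apply: (spectral_decomp_congr HH).
by rewrite -/S' S'E; exact: spectral_decomp_block.
Qed.

End spectral_theorem.

Section spectral_calculus.
Context {R : rcfType} n (S U : 'M[R]_n) (l : 'rV[R]_n).
Hypothesis SUl : spectral_decomp S U l.

Let UU : U *m U^T = 1%:M. Proof. by case: SUl. Qed.
Let UU' : U^T *m U = 1%:M. Proof. exact: mulmx1C. Qed.

Lemma spectral_eigenvalue a : eigenvalue S a = [exists i, l 0 i == a].
Proof.
have [Uu _] := mulmx1_unit UU'; have [_ ->] := SUl.
have {2}-> : U = invmx U^T by rewrite -[LHS](mulKmx Uu) UU' mulmx1.
by rewrite eigenvalue_conj// eigenvalue_diag.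
Qed.

Lemma spectral_coef_eigenvalue i : eigenvalue S (l 0 i).
Proof. by rewrite spectral_eigenvalue; apply/existsP; exists i. Qed.

Lemma spectral_qform x : qform S x = \sum_i l 0 i * (U *m x) i 0 ^+ 2.
Proof. by have [_ ->] := SUl; rewrite qform_congr qform_diag. Qed.

Lemma spectral_qform1 x : qform 1%:M x = \sum_i (U *m x) i 0 ^+ 2.
Proof. by rewrite -UU' qform_gram qform1E. Qed.

Definition spectral_fun (f : R -> R) : 'M[R]_n :=
  U^T *m diag_mx (map_mx f l) *m U.

Lemma spectral_decomp_fun f : spectral_decomp (spectral_fun f) U (map_mx f l).
Proof. by []. Qed.

Lemma spectral_fun_sym f : (spectral_fun f)^T = spectral_fun f.
Proof. by rewrite !trmx_mul trmxK tr_diag_mx mulmxA. Qed.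

Lemma spectral_funM f g :
  spectral_fun f *m spectral_fun g = spectral_fun (fun a => f a * g a).
Proof.
rewrite /spectral_fun !mulmxA; congr (_ *m _); rewrite -!mulmxA; congr (_ *m _).
rewrite (mulmxA U) UU mul1mx mulmx_diag; congr diag_mx.
by apply/rowP => i; rewrite !mxE.
Qed.

Lemma spectral_fun_id : spectral_fun id = S.
Proof. by have [_ ->] := SUl; rewrite /spectral_fun map_mx_id. Qed.

Lemma spectral_fun_eq1 f : (forall a, eigenvalue S a -> f a = 1) ->
  spectral_fun f = 1%:M.
Proof.
move=> f1; rewrite -UU' -[X in X *m U]mulmx1 -diag_const_mx.
congr (_ *m diag_mx _ *m _); apply/rowP => i; rewrite !mxE f1//.
exact: spectral_coef_eigenvalue.
Qed.

End spectral_calculus.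

Section extremal_eigenvalues.
Context {R : realType}.
Implicit Types n : nat.

Lemma lambda_min_lambda_maxN n (S : 'M[R]_n) :
  lambda_min S = - lambda_max (- S).
Proof.
rewrite /lambda_min /inf; congr (- sup _).
apply/seteqP; split=> [_ [a aS <-]|a].
  by rewrite /= eigenvalueN opprK.
by rewrite /= eigenvalueN => aS; exists (- a); rewrite ?opprK.
Qed.

Lemma eigenvalues_has_sup n (S : 'M[R]_n) : (0 < n)%N -> S^T = S ->
  has_sup [set a | eigenvalue S a].
Proof.
move=> n0 Ssym; split; first exact: sym_eigenvalue_exists.
have [U [l Ul]] := sym_spectral Ssym; exists (\sum_i `|l 0 i|) => a /=.
rewrite (spectral_eigenvalue Ul) => /existsP[k /eqP <-].
by rewrite (bigD1 k)//= (le_trans (ler_norm _))// lerDl sumr_ge0.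
Qed.

Lemma eigenvalue_le_lambda_max n (S : 'M[R]_n) a : (0 < n)%N -> S^T = S ->
  eigenvalue S a -> a <= lambda_max S.
Proof.
move=> n0 Ssym; apply: sup_upper_bound; exact: eigenvalues_has_sup.
Qed.

Lemma lambda_max_eigenvalue n (S : 'M[R]_n) : (0 < n)%N -> S^T = S ->
  eigenvalue S (lambda_max S).
Proof.
move=> n0 Ssym; have [U [l Ul]] := sym_spectral Ssym.
have [k _ lk] := arg_maxP (l 0) (erefl : xpredT (Ordinal n0)).
have kS := spectral_coef_eigenvalue Ul k.
suff -> : lambda_max S = l 0 k by [].
apply/le_anti/andP; split; last exact: eigenvalue_le_lambda_max.
apply: ge_sup; first by exists (l 0 k).
move=> a /=; rewrite (spectral_eigenvalue Ul) => /existsP[j /eqP <-]; exact: lk.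
Qed.

Lemma qform_le_lambda_max n (S : 'M[R]_n) x : (0 < n)%N -> S^T = S ->
  qform S x <= lambda_max S * qform 1%:M x.
Proof.
move=> n0 Ssym; have [U [l Ul]] := sym_spectral Ssym.
rewrite (spectral_qform Ul) (spectral_qform1 Ul) big_distrr/=.
apply: ler_sum => i _; rewrite ler_wpM2r ?sqr_ge0// eigenvalue_le_lambda_max//.
exact: (spectral_coef_eigenvalue Ul).
Qed.

Lemma lambda_max_le n (S : 'M[R]_n) c : (0 < n)%N -> S^T = S ->
  (forall x, qform S x <= c * qform 1%:M x) -> lambda_max S <= c.
Proof.
move=> n0 Ssym Sc.
have [v v1 <-] := eigenvalue_qform Ssym (lambda_max_eigenvalue n0 Ssym).
by rewrite -[c]mulr1 -v1.
Qed.

Lemma le_lambda_min n (S : 'M[R]_n) c : (0 < n)%N -> S^T = S ->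
  (forall x, c * qform 1%:M x <= qform S x) -> c <= lambda_min S.
Proof.
move=> n0 Ssym cS; rewrite lambda_min_lambda_maxN lerNr.
apply: lambda_max_le => // [|x].
  by rewrite linearN/= Ssym.
by rewrite qformN mulNr lerN2.
Qed.

Lemma lambda_min_le_qform n (S : 'M[R]_n) x : (0 < n)%N -> S^T = S ->
  lambda_min S * qform 1%:M x <= qform S x.
Proof.
move=> n0 Ssym; rewrite lambda_min_lambda_maxN mulNr lerNl -qformN.
by apply: qform_le_lambda_max => //; rewrite linearN/= Ssym.
Qed.

Lemma lambda_min_eigenvalue n (S : 'M[R]_n) : (0 < n)%N -> S^T = S ->
  eigenvalue S (lambda_min S).
Proof.
move=> n0 Ssym; rewrite lambda_min_lambda_maxN -eigenvalueN.
by apply: lambda_max_eigenvalue => //; rewrite linearN/= Ssym.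
Qed.

Lemma lambda_min_le_eigenvalue n (S : 'M[R]_n) a : (0 < n)%N -> S^T = S ->
  eigenvalue S a -> lambda_min S <= a.
Proof.
move=> n0 Ssym aS; rewrite lambda_min_lambda_maxN lerNl.
rewrite eigenvalue_le_lambda_max ?eigenvalueN ?opprK//.
by rewrite linearN/= Ssym.
Qed.

Lemma ler_lambda_minD n (S S' : 'M[R]_n) : (0 < n)%N -> S^T = S -> S'^T = S' ->
  lambda_min S + lambda_min S' <= lambda_min (S + S').
Proof.
move=> n0 Ssym S'sym; apply: le_lambda_min => // [|x].
  by rewrite linearD/= Ssym S'sym.
by rewrite mulrDl qformD lerD ?lambda_min_le_qform.
Qed.

Lemma ler_lambda_minZ n (S : 'M[R]_n) c : (0 < n)%N -> S^T = S -> 0 <= c ->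
  c * lambda_min S <= lambda_min (c *: S).
Proof.
move=> n0 Ssym c0; apply: le_lambda_min => // [|x].
  by rewrite linearZ/= Ssym.
by rewrite -mulrA qformZ ler_wpM2l ?lambda_min_le_qform.
Qed.

Lemma lambda_min_gt0_posdef n (S : 'M[R]_n) : (0 < n)%N -> S^T = S ->
  0 < lambda_min S -> posdef S.
Proof.
move=> n0 Ssym S0 x x0; apply: lt_le_trans (lambda_min_le_qform x n0 Ssym).
by rewrite mulr_gt0 ?qform1_gt0.
Qed.

Lemma eigenvalue_gt0_posdef n (S : 'M[R]_n) : S^T = S ->
  (forall a, eigenvalue S a -> 0 < a) -> posdef S.
Proof.
case: n S => [|n] S Ssym S0; first by move=> x; rewrite (flatmx0 x) eqxx.
by apply: lambda_min_gt0_posdef => //; exact/S0/lambda_min_eigenvalue.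
Qed.

Lemma psd_lambda_min_ge0 n (S : 'M[R]_n) : (0 < n)%N -> psd S ->
  0 <= lambda_min S.
Proof. by move=> n0 [Ssym S0]; apply: le_lambda_min => // x; rewrite mul0r. Qed.

Lemma psd_lambda_max_ge0 n (S : 'M[R]_n) : (0 < n)%N -> psd S ->
  0 <= lambda_max S.
Proof.
move=> n0 Spsd; have [Ssym _] := Spsd.
apply: le_trans (psd_lambda_min_ge0 n0 Spsd) _.
by apply: eigenvalue_le_lambda_max => //; exact: lambda_min_eigenvalue.
Qed.

Lemma spd_eigenvalue_gt0 n (S : 'M[R]_n) a : spd S -> eigenvalue S a -> 0 < a.
Proof.
move=> [Ssym S0] /(eigenvalue_qform Ssym)[v v1 <-]; apply: S0.
by rewrite -l2norm_eq0 -sqrf_eq0 sqr_l2norm v1 oner_eq0.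
Qed.

Lemma spd_lambda_min_gt0 n (S : 'M[R]_n) : (0 < n)%N -> spd S ->
  0 < lambda_min S.
Proof.
move=> n0 Sspd; apply: (spd_eigenvalue_gt0 Sspd).
by apply: lambda_min_eigenvalue => //; case: Sspd.
Qed.

Lemma spd_invsqrt_exists n (P : 'M[R]_n) : spd P ->
  exists Q, spd Q /\ Q *m Q = invmx P.
Proof.
move=> Pspd; have [Psym _] := Pspd; have [U [l Ul]] := sym_spectral Psym.
pose f a : R := (Num.sqrt a)^-1; pose Q := spectral_fun U l f.
have ffE a : eigenvalue P a -> f a * f a * a = 1.
  move=> /(spd_eigenvalue_gt0 Pspd) a0.
  by rewrite /f -invfM -expr2 sqr_sqrtr ?ltW// mulVf ?gt_eqF.
have QQP : Q *m Q *m P = 1%:M.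
  rewrite -[X in _ *m X](spectral_fun_id Ul) !(spectral_funM Ul).
  exact: (spectral_fun_eq1 Ul).
exists Q; split; last first.
  by rewrite -(mulmxK (spd_unitmx Pspd) (Q *m Q)) QQP mul1mx.
split; first exact: spectral_fun_sym.
apply: eigenvalue_gt0_posdef => [|a]; first exact: spectral_fun_sym.
rewrite (spectral_eigenvalue (spectral_decomp_fun Ul f)) => /existsP[k /eqP <-].
rewrite mxE invr_gt0 sqrtr_gt0; apply: (spd_eigenvalue_gt0 Pspd).
exact: (spectral_coef_eigenvalue Ul).
Qed.

Lemma mx_invsqrt_spd n (P : 'M[R]_n) : spd P -> spd (mx_invsqrt P).
Proof.
move=> /spd_invsqrt_exists exQ; rewrite /mx_invsqrt.
by have [] := xgetPex 0 exQ.
Qed.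

End extremal_eigenvalues.

Section singular_values.
Context {R : realType}.
Implicit Types n : nat.

Let gram_mx_sym n (B : 'M[R]_n) : (B^T *m B)^T = B^T *m B.
Proof. by rewrite trmx_mul trmxK. Qed.

Lemma sigma_max_ge0 n (B : 'M[R]_n) : 0 <= sigma_max B.
Proof. exact: sqrtr_ge0. Qed.

Lemma sigma_max_le n (B : 'M[R]_n) c : (0 < n)%N -> 0 <= c ->
  (forall x, l2norm (B *m x) <= c * l2norm x) -> sigma_max B <= c.
Proof.
move=> n0 c0 Bc; rewrite -(ger0_norm c0) -sqrtr_sqr ler_wsqrtr//.
by apply: lambda_max_le => // x; rewrite qform_gram -l2norm_le_scale.
Qed.

Lemma l2norm_mulmx_le n (B : 'M[R]_n) x : (0 < n)%N ->
  l2norm (B *m x) <= sigma_max B * l2norm x.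
Proof.
move=> n0; rewrite l2norm_le_scale ?sigma_max_ge0//.
have BBpsd : psd (B^T *m B) by rewrite -[B^T]mulmx1; exact/psd_congr/psd1.
rewrite sqr_sqrtr -?qform_gram ?qform_le_lambda_max//.
exact: psd_lambda_max_ge0.
Qed.

Lemma ler_sigma_maxD n (B C : 'M[R]_n) : (0 < n)%N ->
  sigma_max (B + C) <= sigma_max B + sigma_max C.
Proof.
move=> n0; apply: sigma_max_le => // [|x].
  by rewrite addr_ge0 ?sigma_max_ge0.
by rewrite mulmxDl mulrDl (le_trans (ler_l2normD _ _))// lerD ?l2norm_mulmx_le.
Qed.

Lemma ler_sigma_maxZ n c (B : 'M[R]_n) : (0 < n)%N ->
  sigma_max (c *: B) <= `|c| * sigma_max B.
Proof.
move=> n0; apply: sigma_max_le => // [|x].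
  by rewrite mulr_ge0 ?sigma_max_ge0.
by rewrite -scalemxAl l2normZ -mulrA ler_wpM2l ?l2norm_mulmx_le.
Qed.

Lemma ler_sigma_maxM n (B C : 'M[R]_n) : (0 < n)%N ->
  sigma_max (B *m C) <= sigma_max B * sigma_max C.
Proof.
move=> n0; apply: sigma_max_le => // [|x].
  by rewrite mulr_ge0 ?sigma_max_ge0.
rewrite -mulmxA -mulrA (le_trans (l2norm_mulmx_le _ _ _))//.
by rewrite ler_wpM2l ?sigma_max_ge0 ?l2norm_mulmx_le.
Qed.

Lemma sigma_max_gram_scalar_le n (C : 'M[R]_n) r : (0 < n)%N -> 0 <= r ->
  C^T *m C = r%:M -> sigma_max C <= Num.sqrt r.
Proof.
move=> n0 r0 CC; apply: sigma_max_le => // x.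
by rewrite /l2norm -qform_gram CC qform_scalar sqrtrM.
Qed.

Lemma psd_sigma_max_le n (S : 'M[R]_n) : (0 < n)%N -> psd S ->
  sigma_max S <= lambda_max S.
Proof.
move=> n0 Spsd; have [Ssym _] := Spsd; have [U [l Ul]] := sym_spectral Ssym.
have SSE : S^T *m S = spectral_fun U l (fun a => a * a).
  by rewrite Ssym -(spectral_funM Ul) (spectral_fun_id Ul).
have := lambda_max_eigenvalue n0 (gram_mx_sym S).
rewrite /sigma_max {1}SSE (spectral_eigenvalue (spectral_decomp_fun Ul _)).
move=> /existsP[k /eqP <-]; have lk := spectral_coef_eigenvalue Ul k.
have lk0 : 0 <= l 0 k.
  apply: le_trans (psd_lambda_min_ge0 n0 Spsd) _.
  exact: lambda_min_le_eigenvalue.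
by rewrite mxE -expr2 sqrtr_sqr ger0_norm// eigenvalue_le_lambda_max.
Qed.

End singular_values.

(** * Kronecker products *)

Section kronecker_products.
Context {R : comNzRingType}.

Lemma tensmxDl m n p q (X Y : 'M[R]_(m, n)) (Z : 'M[R]_(p, q)) :
  (X + Y) *t Z = X *t Z + Y *t Z.
Proof. by apply/matrixP => i j; rewrite !mxE mulrDl. Qed.

Lemma tensmxZl m n p q a (X : 'M[R]_(m, n)) (Y : 'M[R]_(p, q)) :
  (a *: X) *t Y = a *: (X *t Y).
Proof. by apply/matrixP => i j; rewrite !mxE mulrA. Qed.

Lemma tensmxBr m n p q (X : 'M[R]_(m, n)) (Y Z : 'M[R]_(p, q)) :
  X *t (Y - Z) = X *t Y - X *t Z.
Proof. by apply/matrixP => i j; rewrite !mxE mulrBr. Qed.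

Lemma tens_scalar_scalar_mx m n a b :
  (a%:M : 'M[R]_m) *t (b%:M : 'M[R]_n) = (a * b)%:M.
Proof.
apply/matrixP => i j; case: (mxtens_indexP i) => i1 i2.
case: (mxtens_indexP j) => j1 j2.
rewrite tensmxE !mxE (can_eq (@mxtens_indexK _ _)) xpair_eqE -mulnb.
by rewrite mulrnAl mulrnAr -mulrnA mulnC.
Qed.

Lemma tensmx11 m n : (1%:M : 'M[R]_m) *t (1%:M : 'M[R]_n) = 1%:M.
Proof. by rewrite tens_scalar_scalar_mx mulr1. Qed.

Lemma tensmxX m n (X : 'M[R]_m) (Y : 'M[R]_n) k :
  (X *t Y) ^+ k = X ^+ k *t Y ^+ k.
Proof.
elim: k => [|k IH]; first exact/esym/tensmx11.
by rewrite !exprS IH -!mulmxE tensmx_mul.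
Qed.

Lemma sum_mxtens_index (V : nmodType) m n (F : 'I_(m * n) -> V) :
  \sum_k F k = \sum_i \sum_j F (mxtens_index (i, j)).
Proof.
rewrite pair_big/= (reindex (@mxtens_index m n))/=.
  by apply: eq_bigr => -[].
by exists (@mxtens_unindex m n) => k _; rewrite ?mxtens_indexK ?mxtens_unindexK.
Qed.

Lemma sum_delta_scale (V : lmodType R) n (F : 'I_n -> V) j :
  \sum_i (i == j)%:R *: F i = F j.
Proof.
rewrite (bigD1 j)//= eqxx scale1r big1 ?addr0// => i /negbTE ->.
by rewrite scale0r.
Qed.

End kronecker_products.

Section stacked_vectors.
Context {R : realType} {N : nat}.
Implicit Types (k : nat) (M : 'M[R]_N).

Definition unstack k (x : 'cV[R]_(k * N)) (c : 'I_k) : 'cV[R]_N :=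
  \col_a x (mxtens_index (c, a)) 0.

Lemma unstackK k (x : 'cV[R]_(k * N)) : stack (unstack x) = x.
Proof.
by apply/colP => i; rewrite !mxE -surjective_pairing mxtens_unindexK.
Qed.

Lemma stackP k (v w : 'I_k -> 'cV[R]_N) :
  stack v = stack w <-> forall c, v c = w c.
Proof.
split=> [vw c|vw]; last by congr stack; apply/funext.
apply/colP => a; have /colP/(_ (mxtens_index (c, a))) := vw.
by rewrite !mxE mxtens_indexK.
Qed.

Lemma stack_lin k (v w : 'I_k -> 'cV[R]_N) a :
  stack v + a *: stack w = stack (fun c => v c + a *: w c).
Proof. by apply/colP => i; rewrite !mxE. Qed.

Lemma tensmx_mul_stack k (X : 'M[R]_k) M (v : 'I_k -> 'cV[R]_N) :
  (X *t M) *m stack v = stack (fun c => M *m \sum_j X c j *: v j).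
Proof.
apply/colP => i; case: (mxtens_indexP i) => c a.
rewrite !mxE mxtens_indexK /= sum_mxtens_index exchange_big/=.
apply: eq_bigr => b _; rewrite summxE big_distrr/=.
by apply: eq_bigr => j _; rewrite tensmxE !mxE mxtens_indexK /=; ring.
Qed.

Lemma tens1mx_mul_stack k M (v : 'I_k -> 'cV[R]_N) :
  (1%:M *t M) *m stack v = stack (fun c => M *m v c).
Proof.
rewrite tensmx_mul_stack; apply/stackP => c; congr (_ *m _).
by under eq_bigr => j _ do rewrite mxE eq_sym; exact: sum_delta_scale.
Qed.

Lemma stack_dot k (v w : 'I_k -> 'cV[R]_N) :
  (stack v)^T *m stack w = \sum_c (v c)^T *m w c.
Proof.
apply/matrixP => i j; rewrite !ord1 summxE mxE sum_mxtens_index.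
apply: eq_bigr => c _; rewrite mxE; apply: eq_bigr => a _.
by rewrite !mxE mxtens_indexK.
Qed.

Lemma qform_tens1mx k M (v : 'I_k -> 'cV[R]_N) :
  qform (1%:M *t M) (stack v) = \sum_c qform M (v c).
Proof.
rewrite /qform -mulmxA tens1mx_mul_stack stack_dot summxE.
by apply: eq_bigr => c _; rewrite mulmxA.
Qed.

Lemma qform1_stack k (v : 'I_k -> 'cV[R]_N) :
  qform 1%:M (stack v) = \sum_c qform 1%:M (v c).
Proof. by rewrite -tensmx11 qform_tens1mx. Qed.

Lemma ler_lambda_min_tens1mx k M : (0 < k)%N -> (0 < N)%N -> M^T = M ->
  lambda_min M <= lambda_min ((1%:M : 'M[R]_k) *t M).
Proof.
move=> k0 N0 Msym; apply: le_lambda_min; first by rewrite muln_gt0 k0.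
  by rewrite trmx_tens trmx1 Msym.
move=> x; rewrite -(unstackK x) qform1_stack qform_tens1mx big_distrr/=.
by apply: ler_sum => c _; exact: lambda_min_le_qform.
Qed.

Lemma ler_sigma_max_tens1mx k M : (0 < k)%N -> (0 < N)%N ->
  sigma_max ((1%:M : 'M[R]_k) *t M) <= sigma_max M.
Proof.
move=> k0 N0; apply: sigma_max_le; rewrite ?sigma_max_ge0 ?muln_gt0 ?k0// => x.
rewrite -(unstackK x) tens1mx_mul_stack l2norm_le_scale ?sigma_max_ge0//.
rewrite !qform1_stack big_distrr/=; apply: ler_sum => c _.
by rewrite -l2norm_le_scale ?sigma_max_ge0// l2norm_mulmx_le.
Qed.

Lemma ler_sigma_max_tensmx1 k (C : 'M[R]_k) : (0 < k)%N -> (0 < N)%N ->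
  sigma_max (C *t (1%:M : 'M[R]_N)) <= sigma_max C.
Proof.
move=> k0 N0; apply: sigma_max_le; rewrite ?sigma_max_ge0 ?muln_gt0 ?k0// => x.
rewrite -(unstackK x) tensmx_mul_stack; set v := unstack x.
have qform1_by_columns (w : 'I_k -> 'cV[R]_N) :
    qform 1%:M (stack w) = \sum_a qform 1%:M (\col_c w c a 0).
  rewrite qform1_stack; under eq_bigr do rewrite qform1E.
  rewrite exchange_big; apply: eq_bigr => a _; rewrite qform1E.
  by apply: eq_bigr => c _; rewrite mxE.
rewrite l2norm_le_scale ?sigma_max_ge0// !qform1_by_columns big_distrr/=.
apply: ler_sum => a _; rewrite (_ : \col_c _ = C *m \col_c v c a 0).
  by rewrite -l2norm_le_scale ?sigma_max_ge0// l2norm_mulmx_le.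
apply/colP => c; rewrite mxE mul1mx summxE [RHS]mxE.
by apply: eq_bigr => j _; rewrite !mxE.
Qed.

Lemma ler_sigma_max_tensmx k (C : 'M[R]_k) M : (0 < k)%N -> (0 < N)%N ->
  sigma_max (C *t M) <= sigma_max C * sigma_max M.
Proof.
move=> k0 N0; have kN0 : (0 < k * N)%N by rewrite muln_gt0 k0.
rewrite tensmx_decr; apply: le_trans (ler_sigma_maxM _ _ kN0) _.
apply: ler_pM; rewrite ?sigma_max_ge0//; first exact: ler_sigma_max_tensmx1.
exact: ler_sigma_max_tens1mx.
Qed.

End stacked_vectors.

(** * Conditioning of the stage matrices *)

Section stage_mx_conditioning.
Context {R : realType} {N k : nat}.
Implicit Types (M A Q : 'M[R]_N) (C : 'M[R]_k).

Lemma sym_part_sym n (B : 'M[R]_n) : (sym_part B)^T = sym_part B.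
Proof. by rewrite /sym_part linearZ linearD/= trmxK addrC. Qed.

Lemma sym_part_stage_mx M A dt C : M^T = M -> A^T = A ->
  sym_part (stage_mx M A dt C) = stage_mx M A dt (sym_part C).
Proof.
move=> Msym Asym; rewrite /sym_part /stage_mx [(_ + _)^T]linearD/=.
rewrite [(_ *: _)^T]linearZ/= !trmx_tens trmx1 Msym Asym tensmxZl tensmxDl.
rewrite addrACA -scalerDr [LHS]scalerDr !scalerA.
congr (_ + _); last by rewrite mulrC.
by rewrite -mulr2n -[X in _ *: X]scaler_nat scalerA mulVf ?scale1r// pnatr_eq0.
Qed.

Lemma stage_mx_congr M A Q dt C :
  (1%:M *t Q) *m stage_mx M A dt C *m (1%:M *t Q) =
  stage_mx (Q *m M *m Q) (Q *m A *m Q) dt C.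
Proof.
rewrite /stage_mx mulmxDr mulmxDl -scalemxAr -scalemxAl !tensmx_mul.
by rewrite !mulmx1 !mul1mx.
Qed.

Lemma sigma_max_stage_mx_le M A dt C : (0 < k)%N -> (0 < N)%N -> 0 <= dt ->
  psd M -> psd A ->
  sigma_max (stage_mx M A dt C) <=
  lambda_max M + dt * sigma_max C * lambda_max A.
Proof.
move=> k0 N0 dt0 Mpsd Apsd; have kN0 : (0 < k * N)%N by rewrite muln_gt0 k0.
apply: le_trans (ler_sigma_maxD _ _ kN0) _; apply: lerD.
  by apply: le_trans (ler_sigma_max_tens1mx _ k0 N0) _; exact: psd_sigma_max_le.
apply: le_trans (ler_sigma_maxZ _ _ kN0) _.
rewrite ger0_norm// -mulrA ler_wpM2l//.
apply: le_trans (ler_sigma_max_tensmx _ _ k0 N0) _.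
by rewrite ler_wpM2l ?sigma_max_ge0 ?psd_sigma_max_le.
Qed.

Context (M A : 'M[R]_N) (dt a : R) (C : 'M[R]_k).
Hypotheses (k0 : (0 < k)%N) (N0 : (0 < N)%N) (dt0 : 0 <= dt) (a0 : 0 <= a).
Hypotheses (Mspd : spd M) (Apsd : psd A) (CE : sym_part C = a%:M).

Lemma le_lambda_min_sym_part_stage_mx :
  lambda_min M + dt * a * lambda_min A <=
  lambda_min (sym_part (stage_mx M A dt C)).
Proof.
have [[Msym _] [Asym _]] := (Mspd, Apsd).
have kN0 : (0 < k * N)%N by rewrite muln_gt0 k0.
have tens1_sym (S : 'M[R]_N) : S^T = S -> ((1%:M : 'M[R]_k) *t S)^T = 1%:M *t S.
  by move=> Ssym; rewrite trmx_tens trmx1 Ssym.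
rewrite sym_part_stage_mx// CE /stage_mx -(scalemx1 _ a) tensmxZl scalerA.
apply: le_trans (ler_lambda_minD kN0 _ _); rewrite ?linearZ/= ?tens1_sym//.
apply: lerD; first exact: ler_lambda_min_tens1mx.
apply: le_trans (ler_lambda_minZ kN0 (tens1_sym _ Asym) _); rewrite ?mulr_ge0//.
by apply: ler_wpM2l; [exact: mulr_ge0|exact: ler_lambda_min_tens1mx].
Qed.

Let lambda_min_bound_gt0 : 0 < lambda_min M + dt * a * lambda_min A.
Proof.
rewrite ltr_pwDl ?spd_lambda_min_gt0// mulr_ge0 ?mulr_ge0//.
exact: psd_lambda_min_ge0.
Qed.

Lemma stage_mx_posdef : posdef (sym_part (stage_mx M A dt C)).
Proof.
apply: lambda_min_gt0_posdef; rewrite ?muln_gt0 ?k0//.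
  exact: sym_part_sym.
exact: lt_le_trans le_lambda_min_sym_part_stage_mx.
Qed.

Lemma cond_tilde_stage_mx_le :
  cond_tilde (stage_mx M A dt C) <=
  (lambda_max M + dt * sigma_max C * lambda_max A)
  / (lambda_min M + dt * a * lambda_min A).
Proof.
have lo_gt0 := lt_le_trans lambda_min_bound_gt0 le_lambda_min_sym_part_stage_mx.
apply: ler_pM; rewrite ?sigma_max_ge0 ?invr_ge0 ?(ltW lo_gt0)//.
  by apply: sigma_max_stage_mx_le => //; exact: spd_psd.
by rewrite lef_pV2// le_lambda_min_sym_part_stage_mx.
Qed.

End stage_mx_conditioning.

Section complex_blocks.
Context {R : realType}.
Implicit Types alpha beta : R.

Lemma rot_mx_sym_part alpha beta : sym_part (rot_mx alpha beta) = alpha%:M.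
Proof.
apply/matrixP => i j; rewrite !mxE.
by case: i j => -[|[|//]] ? [[|[|//]] ?] /=; rewrite ?mulr1n ?mulr0n; field.
Qed.

Lemma rot_mx_gram alpha beta :
  (rot_mx alpha beta)^T *m rot_mx alpha beta = (alpha ^+ 2 + beta ^+ 2)%:M.
Proof.
apply/matrixP => i j; rewrite !mxE !big_ord_recl big_ord0 !mxE.
by case: i j => -[|[|//]] ? [[|[|//]] ?] /=; rewrite ?mulr1n ?mulr0n; ring.
Qed.

Lemma cplx_coef_posdef N (M A : 'M[R]_N) dt alpha beta : (0 < N)%N ->
  0 <= dt -> 0 <= alpha -> spd M -> psd A ->
  posdef (sym_part (cplx_coef M A dt alpha beta)).
Proof.
by move=> N0 dt0 alpha0 Mspd Apsd; apply: stage_mx_posdef (rot_mx_sym_part _ _).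
Qed.

Lemma cond_tilde_cplx_coef_le N (M A : 'M[R]_N) dt alpha beta : (0 < N)%N ->
  0 <= dt -> 0 <= alpha -> spd M -> psd A ->
  cond_tilde (cplx_coef M A dt alpha beta) <=
  (lambda_max M + dt * Num.sqrt (alpha ^+ 2 + beta ^+ 2) * lambda_max A)
  / (lambda_min M + dt * alpha * lambda_min A).
Proof.
move=> N0 dt0 alpha0 Mspd Apsd.
have Csym := rot_mx_sym_part alpha beta.
apply: le_trans (cond_tilde_stage_mx_le _ N0 dt0 alpha0 Mspd Apsd Csym) _ => //.
have lA0 := psd_lambda_min_ge0 N0 Apsd; have lM0 := spd_lambda_min_gt0 N0 Mspd.
apply: ler_wpM2r; first by rewrite invr_ge0 addr_ge0 ?(ltW lM0)// !mulr_ge0.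
rewrite lerD2l ler_wpM2r ?psd_lambda_max_ge0// ler_wpM2l//.
apply: sigma_max_gram_scalar_le (rot_mx_gram _ _) => //.
by rewrite addr_ge0 ?sqr_ge0.
Qed.

Lemma precond_cplx_coef_cond_le N (M A P : 'M[R]_N) dt alpha beta :
  (0 < N)%N -> 0 <= dt -> 0 <= alpha -> spd M -> psd A -> spd P ->
  let Q := mx_invsqrt P in
  let PB := (1%:M *t Q) *m cplx_coef M A dt alpha beta *m (1%:M *t Q) in
  posdef (sym_part PB) /\
  cond_tilde PB <=
    (lambda_max (Q *m M *m Q)
     + dt * Num.sqrt (alpha ^+ 2 + beta ^+ 2) * lambda_max (Q *m A *m Q))
    / (lambda_min (Q *m M *m Q) + dt * alpha * lambda_min (Q *m A *m Q)).
Proof.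
move=> N0 dt0 alpha0 Mspd Apsd Pspd Q PB.
have Qspd : spd Q by exact: mx_invsqrt_spd.
have [Qsym _] := Qspd; have Qu := spd_unitmx Qspd.
have QMQspd : spd (Q *m M *m Q) by rewrite -{1}Qsym; exact: spd_congr.
have QAQpsd : psd (Q *m A *m Q) by rewrite -{1}Qsym; exact: psd_congr.
rewrite /PB [_ *m _ *m _](stage_mx_congr M A Q dt (rot_mx alpha beta)).
by split; [exact: cplx_coef_posdef|exact: cond_tilde_cplx_coef_le].
Qed.

End complex_blocks.

(** * Eigenvalues of a real Jordan form *)

Section kronecker_eigenvalues.
Context {F : fieldType}.

Lemma nilpotent_add1_unitmx n (X : 'M[F]_n) k :
  X ^+ k = 0 -> 1%:M + X \in unitmx.
Proof.
move=> Xk; have := subrX1 (- X) k; rewrite exprNn Xk mulr0 sub0r -mulmxE.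
move=> /(congr1 -%R); rewrite opprK -mulNmx opprB opprK => /esym.
by move=> /mulmx1_unit[].
Qed.

Lemma nilpotent_left_kernel n (S : 'M[F]_n) k (u : 'rV[F]_n) :
  u != 0 -> u *m S ^+ k = 0 -> exists2 w : 'rV[F]_n, w != 0 & w *m S = 0.
Proof.
elim: k u => [|k IH] u u0.
  by rewrite mulmx1 => u00; rewrite u00 eqxx in u0.
rewrite exprS -mulmxE mulmxA; have [uS|uS] := eqVneq (u *m S) 0; last exact: IH.
by exists u.
Qed.

Lemma tens_rV_neq0 m n (u : 'rV[F]_m) (w : 'rV[F]_n) :
  u != 0 -> w != 0 -> u *t w != 0.
Proof.
move=> /rV0Pn[i ui] /rV0Pn[j wj]; apply/matrix0Pn.
exists (mxtens_index (0, 0)), (mxtens_index (i, j)).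
by rewrite tensmxE mulf_neq0.
Qed.

Lemma tens1D_nilpotent_unitmx m n (S : 'M[F]_m) (L : 'M[F]_n) k :
  (0 < m)%N -> S ^+ k = 0 ->
  (1%:M *t L + S *t 1%:M \in unitmx) = (L \in unitmx).
Proof.
move=> m0 Sk; apply/idP/idP => [Xu|Lu].
  rewrite -row_free_unit -kermx_eq0; apply: contraT.
  move=> /rowV0Pn[w /sub_kermxP wL w0].
  have e0 : delta_mx 0 (Ordinal m0) != 0 :> 'rV[F]_m.
    by apply/rV0Pn; exists (Ordinal m0); rewrite mxE !eqxx oner_eq0.
  have [|u u0 uS] := @nilpotent_left_kernel _ S k _ e0.
    by rewrite Sk mulmx0.
  have := tens_rV_neq0 u0 w0; rewrite -(mulmxK Xu (u *t w)) mulmxDr !tensmx_mul.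
  by rewrite wL uS tensmx0 tens0mx addr0 mul0mx eqxx.
have -> : 1%:M *t L + S *t 1%:M = (1%:M *t L) *m (1%:M + S *t invmx L).
  by rewrite mulmxDr mulmx1 tensmx_mul mul1mx mulmxV.
rewrite unitmx_mul; apply/andP; split.
  have LL : (1%:M *t L) *m (1%:M *t invmx L) = (1%:M : 'M[F]_(m * n)).
    by rewrite tensmx_mul mulmxV// mul1mx tensmx11.
  by have [] := mulmx1_unit LL.
by apply: (@nilpotent_add1_unitmx _ _ k); rewrite tensmxX Sk tens0mx.
Qed.

Lemma eigenvalue_tens1D_nilpotent m n (S : 'M[F]_m) (K : 'M[F]_n) k a :
  (0 < m)%N -> S ^+ k = 0 ->
  eigenvalue (1%:M *t K + S *t 1%:M) a = eigenvalue K a.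
Proof.
move=> m0 Sk; rewrite !eigenvalue_unitmx.
rewrite -(tens1D_nilpotent_unitmx (K - a%:M) m0 Sk).
by rewrite tensmxBr tens_scalar_scalar_mx mul1r addrAC.
Qed.

End kronecker_eigenvalues.

Section matrix_facts.
Context {R : comNzRingType}.

Lemma det_mx22 (X : 'M[R]_2) : \det X = X 0 0 * X 1 1 - X 0 1 * X 1 0.
Proof.
have lift0E : lift (0 : 'I_2) (0 : 'I_1) = 1 by exact: val_inj.
have lift1E : lift (1 : 'I_2) (0 : 'I_1) = 0 by exact: val_inj.
rewrite (expand_det_row X 0) big_ord_recl big_ord1 /cofactor !det_mx11 !mxE.
by rewrite !lift0E lift1E/=; ring.
Qed.

Lemma strict_upper_trig_nilpotent n (S : 'M[R]_n) :
  (forall i j : 'I_n, (j <= i)%N -> S i j = 0) -> S ^+ n = 0.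
Proof.
move=> S0; have expS0 k (i j : 'I_n) : (j < i + k)%N -> (S ^+ k) i j = 0.
  elim: k j => [|k IH] j.
    by rewrite addn0 expr0 mxE; case: eqP => // ->; rewrite ltnn.
  rewrite addnS ltnS exprSr -mulmxE mxE => jik; apply: big1 => m _.
  have [mik|ikm] := ltnP m (i + k); first by rewrite IH ?mul0r.
  by rewrite S0 ?mulr0// (leq_trans jik).
apply/matrixP => i j; rewrite [RHS]mxE expS0//.
by rewrite (leq_trans (ltn_ord j))// leq_addl.
Qed.

Lemma map_mxdiag (K : comNzRingType) (f : {rmorphism R -> K}) p
    (p_ : 'I_p -> nat) (D : forall q, 'M[R]_(p_ q)) :
  map_mx f (\mxdiag_q D q) = \mxdiag_q map_mx f (D q).
Proof.
apply/mxblockP => i j; rewrite /mxdiag mxblockK.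
transitivity (map_mx f (submxblock (\mxdiag_q D q) i j)).
  by apply/matrixP => k l; rewrite !mxE.
rewrite /mxdiag mxblockK; case: eqVneq => [->|_]; last exact: map_mx0.
by rewrite !conform_mx_id.
Qed.

End matrix_facts.

Section jordan_eigenvalues.
Context {R : realType}.

Lemma eigenvalue_rot_mx (alpha beta : R) (z : R[i]) :
  eigenvalue (map_mx (real_complex R) (rot_mx alpha beta)) z <->
  z = alpha +i* beta \/ z = alpha +i* (- beta).
Proof.
rewrite eigenvalue_unitmx unitmxE unitfE negbK det_mx22 !mxE/=.
have -> : (alpha%:C - z *+ 1) * (alpha%:C - z *+ 1)
    - (beta%:C - z *+ 0) * ((- beta)%:C - z *+ 0) =
    (z - (alpha +i* beta)) * (z - (alpha +i* (- beta))).
  have -> : alpha +i* beta = alpha%:C + 'i%C * beta%:C by rewrite [LHS]complexE.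
  have -> : alpha +i* (- beta) = alpha%:C - 'i%C * beta%:C.
    by rewrite [LHS]complexE/= rmorphN mulrN.
  rewrite rmorphN/= mulr1n mulr0n.
  transitivity ((z - alpha%:C) ^+ 2 - 'i%C ^+ 2 * beta%:C ^+ 2); last by ring.
  by rewrite sqr_i; ring.
rewrite mulf_eq0 !subr_eq0; split=> [/orP[]/eqP|]; [by left|by right|].
by case=> ->; rewrite eqxx ?orbT.
Qed.

Definition jb_eigenvalue (b : jordan_block R) (z : R[i]) : Prop :=
  match b with
  | RealBlock mu _ => z = mu%:C
  | CplxBlock alpha beta _ => z = alpha +i* beta \/ z = alpha +i* (- beta)
  end.

Lemma eigenvalue_jb_mx (b : jordan_block R) (z : R[i]) :
  eigenvalue (map_mx (real_complex R) (jb_mx b)) z <-> jb_eigenvalue b z.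
Proof.
have len_gt0 : (0 < jb_len b)%N by case: b.
have shift_nilp : map_mx (real_complex R) (shift_mx (jb_len b)) ^+ jb_len b = 0.
  apply: strict_upper_trig_nilpotent => i j ji.
  by rewrite !mxE ltn_eqF// ltnS.
rewrite map_mxD !map_mxT !map_mx1.
rewrite (eigenvalue_tens1D_nilpotent _ _ len_gt0 shift_nilp).
case: b {len_gt0 shift_nilp} => [mu m|alpha beta m] /=.
  by rewrite map_scalar_mx eigenvalue_scalar//; split=> [/eqP|->].
exact: eigenvalue_rot_mx.
Qed.

Section real_jordan_form.
Context (s p : nat) (Gamma T : 'M[R]_s) (B : 'I_p -> jordan_block R).
Context (hs : (\sum_(q < p) jb_len (B q) * jb_dim (B q))%N = s).
Hypothesis hJ : real_jordan_form Gamma T hs.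

Lemma jordan_form_eigenvalue (z : R[i]) :
  eigenvalue (map_mx (real_complex R) Gamma) z <->
  exists q, jb_eigenvalue (B q) z.
Proof.
case: hJ => Tu _ ->; rewrite !map_mxM map_invmx eigenvalue_conj ?map_unitmx//.
case: _ / hs; rewrite /jordan_mx castmx_id map_mxdiag eigenvalue_mxdiag.
by split=> [/existsP[q /eigenvalue_jb_mx]|[q /eigenvalue_jb_mx Bq]];
  [exists q|apply/existsP; exists q].
Qed.

Lemma jordan_form_real_eigenvalue (x : R) :
  eigenvalue Gamma x <-> exists q m, B q = RealBlock x m.
Proof.
rewrite -(eigenvalue_map (real_complex R)) jordan_form_eigenvalue.
split=> [[q]|[q [m Bq]]]; last by exists q; rewrite Bq.
case Bq : (B q) => [mu m|alpha beta m] /=; first by move=> [->]; exists q, m.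
have [_ beta_neq0 _] := hJ; move/eqP: (beta_neq0 _ _ _ _ Bq) => b0.
by case=> -[_ b]; case: b0 => //; apply: oppr_inj; rewrite oppr0.
Qed.

Lemma jordan_form_complex_eigenvalue (z : R[i]) : complex.Im z != 0 ->
  eigenvalue (map_mx (real_complex R) Gamma) z <->
  exists q alpha beta m, B q = CplxBlock alpha beta m /\
    (z = alpha +i* beta \/ z = alpha +i* (- beta)).
Proof.
move=> Imz; rewrite jordan_form_eigenvalue.
split=> [[q]|[q [alpha [beta [m [Bq zE]]]]]]; last by exists q; rewrite Bq.
case Bq : (B q) => [mu m|alpha beta m] /= zE; last by exists q, alpha, beta, m.
by rewrite zE/= eqxx in Imz.
Qed.

Hypothesis Gamma_ge0 : forall z : R[i],
  eigenvalue (map_mx (real_complex R) Gamma) z -> 0 <= complex.Re z.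

Lemma jordan_form_mu_ge0 q mu m : B q = RealBlock mu m -> 0 <= mu.
Proof.
move=> Bq; apply: (Gamma_ge0 (z := mu%:C)).
by apply/jordan_form_eigenvalue; exists q; rewrite Bq.
Qed.

Lemma jordan_form_alpha_ge0 q alpha beta m : B q = CplxBlock alpha beta m ->
  0 <= alpha.
Proof.
move=> Bq; apply: (Gamma_ge0 (z := alpha +i* beta)).
by apply/jordan_form_eigenvalue; exists q; rewrite Bq; left.
Qed.

End real_jordan_form.
End jordan_eigenvalues.

(** * The transformed stage system *)

Section stage_systems.
Context {R : realType} {N : nat}.
Implicit Types (M A : 'M[R]_N) (dt : R).

Lemma tensmx1_mul_stack k (X : 'M[R]_k) (v : 'I_k -> 'cV[R]_N) :
  (X *t 1%:M) *m stack v = stack (fun c => \sum_j X c j *: v j).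
Proof. by rewrite tensmx_mul_stack; apply/stackP => c; rewrite mul1mx. Qed.

Lemma stage_mx_mul_stack M A dt k (X : 'M[R]_k) (v : 'I_k -> 'cV[R]_N) :
  stage_mx M A dt X *m stack v =
  stack (fun c => M *m v c + dt *: (A *m \sum_j X c j *: v j)).
Proof.
by rewrite mulmxDl -scalemxAl tens1mx_mul_stack tensmx_mul_stack stack_lin.
Qed.

Lemma stage_systemE M A dt s (Gamma : 'M[R]_s) u v :
  stage_system M A dt Gamma u v <->
  stage_mx M A dt Gamma *m stack v = stack (fun=> - (A *m u)).
Proof. by rewrite stage_mx_mul_stack stackP. Qed.

Section conjugation.
Context (M A : 'M[R]_N) (dt : R) (s : nat) (J T : 'M[R]_s).
Hypothesis Tu : T \in unitmx.

Let T1VK : (invmx T *t 1%:M) *m (T *t 1%:M) = 1%:M :> 'M[R]_(s * N).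
Proof. by rewrite tensmx_mul mulVmx// mulmx1 tensmx11. Qed.

Lemma stage_mx_conj :
  stage_mx M A dt (T *m J *m invmx T) =
  (T *t 1%:M) *m stage_mx M A dt J *m (invmx T *t 1%:M).
Proof.
rewrite /stage_mx mulmxDr mulmxDl -scalemxAr -scalemxAl !tensmx_mul.
by rewrite !mulmx1 !mul1mx mulmxV.
Qed.

Lemma transformed_stage_mx_conj :
  transformed_stage_mx M A dt (T *m J *m invmx T) T = stage_mx M A dt J.
Proof.
rewrite /transformed_stage_mx stage_mx_conj !mulmxA T1VK mul1mx -mulmxA T1VK.
exact: mulmx1.
Qed.

Lemma stage_system_conj u v :
  stage_system M A dt (T *m J *m invmx T) u v <->
  forall k, M *m (\sum_j invmx T k j *: v j)
    + dt *: (A *m \sum_j J k j *: \sum_l invmx T j l *: v l) =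
    \sum_j invmx T k j *: - (A *m u).
Proof.
rewrite stage_systemE stage_mx_conj -[_ *m stack v]mulmxA tensmx1_mul_stack.
rewrite -[_ *m stack _]mulmxA stage_mx_mul_stack -stackP.
rewrite -(tensmx1_mul_stack _ (fun=> - (A *m u))).
by split=> [<-|->]; rewrite mulmxA ?T1VK ?(mulmx1C T1VK) mul1mx.
Qed.

End conjugation.

Lemma next_or_0E m r (w : 'I_m -> 'I_r -> 'cV[R]_N) i c :
  next_or_0 w i c = \sum_(i' < m) (i' == i.+1 :> nat)%:R *: w i' c.
Proof.
rewrite /next_or_0; case: insubP => [j _ ji|nlt].
  rewrite -ji; under eq_bigr => i' _ do rewrite val_eqE.
  by rewrite sum_delta_scale.
rewrite big1// => i' _; case: eqP => [ii|]; last by rewrite scale0r.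
by move: nlt; rewrite -ii ltn_ord.
Qed.

Lemma jb_mxE b (i i' : 'I_(jb_len b)) (c c' : 'I_(jb_dim b)) :
  @jb_mx R b (mxtens_index (i, c)) (mxtens_index (i', c')) =
  (i' == i)%:R * jb_core b c c' + (c' == c)%:R * (i' == i.+1 :> nat)%:R.
Proof.
rewrite /jb_mx mxE !tensmxE !mxE [i == _]eq_sym [c == _]eq_sym.
by rewrite [X in _ + X]mulrC.
Qed.

Lemma jb_mx_row_sum (V : lmodType R) b (i : 'I_(jb_len b)) c
    (w : 'I_(jb_len b * jb_dim b) -> V) :
  \sum_l @jb_mx R b (mxtens_index (i, c)) l *: w l =
  \sum_c' jb_core b c c' *: w (mxtens_index (i, c'))
  + \sum_(i' < jb_len b) (i' == i.+1 :> nat)%:R *: w (mxtens_index (i', c)).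
Proof.
rewrite sum_mxtens_index.
under eq_bigr => i' _.
  under eq_bigr => c' _ do rewrite jb_mxE scalerDl -!scalerA.
  rewrite big_split/= -scaler_sumr sum_delta_scale; over.
by rewrite big_split/= sum_delta_scale.
Qed.

Lemma sum_tagnat_Rank (V : nmodType) p (p_ : 'I_p -> nat)
    (F : 'I_(\sum_q p_ q) -> V) :
  \sum_j F j = \sum_q \sum_k F (tagnat.Rank q k).
Proof.
rewrite sig_big_dep (reindex _ tagnat.sig_bij_on)/=.
by apply: eq_bigr => j _; rewrite tagnat.sig2K.
Qed.

Lemma mxdiag_row_sum (V : lmodType R) p (p_ : 'I_p -> nat)
    (D : forall q, 'M[R]_(p_ q)) (w : 'I_(\sum_q p_ q) -> V) q k :
  \sum_j (\mxdiag_q D q) (tagnat.Rank q k) j *: w j =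
  \sum_l D q k l *: w (tagnat.Rank q l).
Proof.
have mxdiagE q' l : (\mxdiag_q D q) (tagnat.Rank q k) (tagnat.Rank q' l) =
    submxblock (\mxdiag_q D q) q q' k l by rewrite [RHS]mxE.
rewrite sum_tagnat_Rank.
rewrite (bigD1 q)//= [X in _ + X]big1 ?addr0 => [|q' q'q].
  by apply: eq_bigr => l _; rewrite mxdiagE submxblock_diag.
apply: big1 => l _; rewrite mxdiagE /mxdiag mxblockK eq_sym (negbTE q'q).
by rewrite mxE scale0r.
Qed.

Section jordan_rows.
Context (s p : nat) (B : 'I_p -> jordan_block R).
Context (hs : (\sum_(q < p) jb_len (B q) * jb_dim (B q))%N = s).

Lemma jordan_index_surj k : exists q i c, k = @jordan_index R p B s hs q i c.
Proof.
case: _ / hs k => k; rewrite -(tagnat.sig2K k).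
case: (mxtens_indexP (tagnat.sig2 k)) => i c; exists (tagnat.sig1 k), i, c.
by rewrite /jordan_index cast_ord_id.
Qed.

Lemma jordan_index_eq q (i : 'I_(jb_len (B q))) c c' :
  (jordan_index hs i c == jordan_index hs i c') = (c == c').
Proof.
apply/eqP/eqP => [|->//]; rewrite /jordan_index => /cast_ord_inj /eqP.
rewrite -val_eqE/= tagnat.eq_Rank eqxx/= => /eqP.
by move=> /addnI/ord_inj.
Qed.

Lemma jordan_mx_core q (i : 'I_(jb_len (B q))) c c' :
  jordan_mx hs (jordan_index hs i c) (jordan_index hs i c') =
  jb_core (B q) c c'.
Proof.
case: _ / hs; rewrite /jordan_mx castmx_id /jordan_index !cast_ord_id.
have /matrixP/(_ (mxtens_index (i, c)) (mxtens_index (i, c'))) :=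
  submxblock_diag (fun q => jb_mx (B q)) q.
by rewrite mxE => ->; rewrite jb_mxE eqxx mul1r ltn_eqF// mulr0 addr0.
Qed.

Lemma jordan_row_sum (w : 'I_s -> 'cV[R]_N) q (i : 'I_(jb_len (B q))) c :
  \sum_j jordan_mx hs (jordan_index hs i c) j *: w j =
  \sum_c' jb_core (B q) c c' *: w (jordan_index hs i c')
  + next_or_0 (fun i c => w (jordan_index hs i c)) i c.
Proof.
rewrite next_or_0E /jordan_index /jordan_mx; case: _ / hs w => w.
rewrite castmx_id cast_ord_id mxdiag_row_sum jb_mx_row_sum.
by congr (_ + _); apply: eq_bigr => k _; rewrite cast_ord_id.
Qed.

End jordan_rows.

Lemma block_substitutionE M A dt (b : jordan_block R) g w :
  block_substitution M A dt (b := b) g w <->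
  forall i c, M *m w i c
    + dt *: (A *m (\sum_c' jb_core b c c' *: w i c' + next_or_0 w i c)) = g i c.
Proof.
have move_next (b' : jordan_block R) g' w' i c :
    M *m w' i c + dt *: (A *m (\sum_c' jb_core b' c c' *: w' i c'
      + next_or_0 w' i c)) = g' i c <->
    M *m w' i c + dt *: (A *m \sum_c' jb_core b' c c' *: w' i c') =
    g' i c - dt *: (A *m next_or_0 w' i c).
  by rewrite mulmxDr scalerDr addrA; split=> [<-|->]; rewrite ?addrK ?subrK.
case: b g w => [mu m|alpha beta m] g w; split=> h i.
- move=> c; apply/move_next; rewrite !ord1 big_ord1 mxE eqxx -h mulmxDl.
  by rewrite -scalemxAl -scalemxAr scalerA mulrC.
- have /move_next := h i ord0; rewrite big_ord1 mxE eqxx => <-.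
  by rewrite mulmxDl -scalemxAl -scalemxAr scalerA mulrC.
- move=> c; apply/move_next; have := h i; rewrite [LHS]stage_mx_mul_stack.
  rewrite tens1mx_mul_stack -scaleNr stack_lin => /stackP/(_ c) ->.
  by rewrite scaleNr.
- rewrite tens1mx_mul_stack -scaleNr stack_lin [LHS]stage_mx_mul_stack.
  by apply/stackP => c; have /move_next := h i c; rewrite scaleNr.
Qed.

Lemma jordan_substitutionP M A dt s (Gamma T : 'M[R]_s) p
    (B : 'I_p -> jordan_block R)
    (hs : (\sum_(q < p) jb_len (B q) * jb_dim (B q))%N = s) u v :
  real_jordan_form Gamma T hs ->
  stage_system M A dt Gamma u v <-> jordan_substitution M A dt T hs u v.
Proof.
move=> [Tu _ ->]; rewrite stage_system_conj// /jordan_substitution.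
split=> h.
  move=> q; apply/block_substitutionE => i c.
  by rewrite -(jordan_row_sum hs (fun k => \sum_j invmx T k j *: v j)) h.
move=> k; have [q [i [c ->]]] := jordan_index_surj hs k.
by rewrite jordan_row_sum; have /block_substitutionE := h q; apply.
Qed.

Section pivot_blocks.
Context (M A : 'M[R]_N) (dt : R) (s p : nat) (Gamma T : 'M[R]_s).
Context (B : 'I_p -> jordan_block R).
Context (hs : (\sum_(q < p) jb_len (B q) * jb_dim (B q))%N = s).
Hypothesis hJ : real_jordan_form Gamma T hs.

Lemma transformed_stage_mx_jordan :
  transformed_stage_mx M A dt Gamma T = stage_mx M A dt (jordan_mx hs).
Proof. by case: hJ => Tu _ ->; exact: transformed_stage_mx_conj. Qed.

Lemma pivot_block_stage_mx q (i : 'I_(jb_len (B q))) :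
  pivot_block M A dt Gamma T hs i = stage_mx M A dt (jb_core (B q)).
Proof.
rewrite /pivot_block transformed_stage_mx_jordan.
apply/matrixP => k l; case: (mxtens_indexP k) => c a.
case: (mxtens_indexP l) => c' a'.
rewrite mxE !mxtens_indexK /= /stage_mx !mxE !mxtens_indexK /= jordan_mx_core.
by rewrite jordan_index_eq.
Qed.

Lemma cond_pivot_block q (i : 'I_(jb_len (B q))) :
  cond_tilde (pivot_block M A dt Gamma T hs i) = block_cond M A dt (B q).
Proof.
rewrite pivot_block_stage_mx; case: (B q) => //= mu _.
rewrite /stage_mx !tens_scalar_mx scale1r /real_coef mulrC -scalerA.
by case: _ / (esym (mul1n N)); rewrite !castmx_id.
Qed.

Lemma rk_conditioningE :
  rk_conditioning M A dt Gamma T hs =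
  \big[Num.max/0]_(q < p) block_cond M A dt (B q).
Proof.
rewrite /rk_conditioning.
under eq_bigr => q _ do under eq_bigr => i _ do rewrite cond_pivot_block.
apply/le_anti/andP; split; apply: bigmax_le => [|q _]; rewrite ?bigmax_ge_id//.
  apply: bigmax_le => [|i _]; rewrite ?bigmax_ge_id//.
  exact: (le_bigmax _ (fun q => block_cond M A dt (B q))).
have i0 : 'I_(jb_len (B q)) by case: (B q) => [mu m|alpha beta m]; exact: ord0.
apply: le_trans (le_bigmax _ (fun=> block_cond M A dt (B q)) i0) _.
exact: (le_bigmax _
  (fun q => \big[Num.max/0]_(i < jb_len (B q)) block_cond M A dt (B q))).
Qed.

End pivot_blocks.
End stage_systems.

(** * Lebesgue measure on row vectors *)

Section open_sets_rV.
Context {R : realType} {d : nat}.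
Implicit Types (x : 'rV[R]_d) (U : set 'rV[R]_d).

Lemma ball_rVE x (e : R) : 0 < e ->
  ball x e = [set y | forall i, ball (x ord0 i) e (y ord0 i)].
Proof.
move=> e0; apply/seteqP; split=> y; first by move=> [_ xy] i; exact: xy.
by move=> xy; split=> // i j; rewrite ord1; exact: xy.
Qed.

Lemma measurable_ball_rV x (e : R) : 0 < e -> measurable (ball x e).
Proof.
move=> e0; rewrite ball_rVE// [X in measurable X](_ : _ =
    \bigcap_(i in [set: 'I_d]) rV_coord i @^-1` ball (x ord0 i) e); last first.
  by apply/seteqP; split=> y xy i; [move=> _|]; exact: xy.
apply: fin_bigcap_measurable => // i _; rewrite -[X in measurable X]setTI.
by apply: measurable_rV_coord => //; exact: measurable_ball.
Qed.

Lemma lebesgue_rV_ball x (e : R) : 0 < e ->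
  lebesgue_rV d (ball x e) = ((e *+ 2) ^+ d)%:E.
Proof.
move=> e0; rewrite ball_rVE//.
rewrite (@lebesgue_rV_box R d (fun i => ball (x ord0 i) e)).
  under eq_bigr do rewrite lebesgue_measure_ball ?ltW//.
  by rewrite prodEFin prodr_const card_ord.
by move=> i; exact: measurable_ball.
Qed.

Lemma rat_approx_rV x (e : R) : 0 < e ->
  exists c : {ffun 'I_d -> rat}, ball (\row_i ratr (c i) : 'rV[R]_d) e x.
Proof.
move=> e0.
have /choice[c cE] i : exists q : rat, ball (ratr q : R) e (x ord0 i).
  have [|q] := @rat_in_itvoo R (x ord0 i - e) (x ord0 i + e).
    by rewrite ltrD2l gtrN.
  by rewrite in_itv/= => qE; exists q; rewrite /ball/= distrC ltr_distlC.
exists [ffun i => c i]; split=> // i j; rewrite !mxE ord1 ffunE; exact: cE.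
Qed.

(* Every open set is the union of the balls with rational data it contains. *)
Lemma open_measurable_rV U : open U -> measurable U.
Proof.
move=> oU.
pose qball (k : {ffun 'I_d -> rat} * nat) : set 'rV[R]_d :=
  ball (\row_i ratr (k.1 i) : 'rV[R]_d) (k.2.+1%:R^-1 : R).
pose F k := if pselect (qball k `<=` U) then qball k else set0.
have -> : U = \bigcup_k F k.
  apply/seteqP; split=> [x Ux|x [k _]]; last first.
    by rewrite /F; case: pselect => // kU; exact: kU.
  have /nbhs_ballP[e /= e0 eU] : nbhs x U by exact: open_nbhs_nbhs.
  have [n _ /(_ n (leqnn n))/= ne] :=
    near_infty_natSinv_lt (PosNum (divr_gt0 e0 (ltr0Sn R 1))).
  have [c cx] := @rat_approx_rV x n.+1%:R^-1 (eqbRL (invr_gt0 _) (ltr0Sn R n)).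
  exists (c, n) => //; rewrite /F; case: pselect => [//|[]] y cy; apply: eU.
  apply: (@ball_splitr _ _ (\row_i ratr (c i) : 'rV[R]_d)).
    exact: (le_ball (ltW ne)) cx.
  exact: (le_ball (ltW ne)) cy.
apply: countable_bigcupT_measurable => [|k]; first exact: countableP.
rewrite /F; case: pselect => kU; last exact: measurable0.
exact: measurable_ball_rV.
Qed.

Lemma open_continuous_measurable_rV U (f : 'rV[R]_d -> R) : open U ->
  {in U, continuous f} -> measurable_fun U f.
Proof.
move=> oU cf; apply: (measurability _ (RGenOpens.measurableE R)).
move=> _ [_ [a [b ->] <-]]; apply: open_measurable_rV.
rewrite openE => x [Ux fx]; apply: filterI; first exact: open_nbhs_nbhs.
by apply: (cf x (mem_set Ux)); apply: open_nbhs_nbhs.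
Qed.

Lemma open_lebesgue_rV_gt0 U : open U -> U !=set0 -> (0 < lebesgue_rV d U)%E.
Proof.
move=> oU [x Ux].
have /nbhs_ballP[e /= e0 eU] : nbhs x U by exact: open_nbhs_nbhs.
apply: (@lt_le_trans _ _ (lebesgue_rV d (ball x e))).
  by rewrite lebesgue_rV_ball// lte_fin exprn_gt0// pmulrn_lgt0.
apply: le_measure => //; rewrite inE; first exact: measurable_ball_rV.
exact: open_measurable_rV.
Qed.

Lemma bounded_lebesgue_rV_lty U : open U -> bounded_set U ->
  (lebesgue_rV d U < +oo)%E.
Proof.
move=> oU [K [_ UK]]; pose r := `|K| + 1.
have Kr : K < r by rewrite (le_lt_trans (ler_norm K))// ltrDl.
have r0 : 0 < r + 1 by rewrite ltr_wpDl// addr_ge0.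
apply: (@le_lt_trans _ _ (lebesgue_rV d (ball (0 : 'rV[R]_d) (r + 1)))).
  apply: le_measure; rewrite ?inE.
  - exact: open_measurable_rV.
  - exact: measurable_ball_rV.
  - move=> x Ux; rewrite -ball_normE /ball_/= sub0r normrN.
    by rewrite (le_lt_trans (UK _ Kr _ Ux))// ltrDl.
by rewrite lebesgue_rV_ball ?ltry.
Qed.

End open_sets_rV.

Section bounded_measurable.
Context {R : realType} {d : nat} (U : set 'rV[R]_d).
Hypotheses (oU : open U) (bU : bounded_set U).
Local Notation mu := (lebesgue_rV d).

Let mU : measurable U. Proof. exact: open_measurable_rV. Qed.

Definition bdd_meas (f : 'rV[R]_d -> R) :=
  measurable_fun U f /\ exists C : R, forall x, U x -> `|f x| <= C.

Lemma bdd_measD f g : bdd_meas f -> bdd_meas g -> bdd_meas (fun x => f x + g x).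
Proof.
move=> [mf [C fC]] [mg [C' gC']]; split; first exact: measurable_funD.
by exists (C + C') => x Ux; rewrite (le_trans (ler_normD _ _))// lerD ?fC ?gC'.
Qed.

Lemma bdd_measM f g : bdd_meas f -> bdd_meas g -> bdd_meas (fun x => f x * g x).
Proof.
move=> [mf [C fC]] [mg [C' gC']]; split; first exact: measurable_funM.
by exists (C * C') => x Ux; rewrite normrM ler_pM ?fC ?gC'.
Qed.

Lemma bdd_meas_cst c : bdd_meas (fun=> c).
Proof. by split; [exact: measurable_cst|exists `|c|]. Qed.

Lemma bdd_meas_sum (I : Type) (r : seq I) (F : I -> 'rV[R]_d -> R) :
  (forall i, bdd_meas (F i)) -> bdd_meas (fun x => \sum_(i <- r) F i x).
Proof.
move=> bF; elim: r => [|i r IH].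
  by under eq_fun do rewrite big_nil; exact: bdd_meas_cst.
by under eq_fun do rewrite big_cons; exact: bdd_measD.
Qed.

Lemma bdd_measZ c f : bdd_meas f -> bdd_meas (fun x => c * f x).
Proof. by move=> bf; apply: bdd_measM => //; exact: bdd_meas_cst. Qed.

Lemma eq_bdd_meas f g :
  (forall x, U x -> f x = g x) -> bdd_meas f -> bdd_meas g.
Proof.
move=> fg [mf [C fC]]; split; last by exists C => x Ux; rewrite -fg ?fC.
by apply: eq_measurable_fun mf => x; rewrite inE; exact: fg.
Qed.

Lemma bdd_meas_integrable f : bdd_meas f -> mu.-integrable U (EFin \o f).
Proof.
move=> [mf [C fC]]; apply: measurable_bounded_integrable => //.
  exact: bounded_lebesgue_rV_lty.
exists C; split; first exact: num_real.
by move=> r Cr x Ux /=; rewrite (le_trans (fC _ Ux))// ltW.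
Qed.

Lemma Rintegral_lin_sum (I : Type) (r : seq I) (c : I -> R)
    (F : I -> 'rV[R]_d -> R) :
  (forall i, bdd_meas (F i)) ->
  Rintegral mu U (fun x => \sum_(i <- r) c i * F i x) =
  \sum_(i <- r) c i * Rintegral mu U (F i).
Proof.
move=> bF; have bcF i : bdd_meas (fun x => c i * F i x) by exact: bdd_measZ.
elim: r => [|i r IH].
  under eq_Rintegral do rewrite big_nil.
  by rewrite big_nil Rintegral_cst// mul0r.
under eq_Rintegral do rewrite big_cons.
rewrite big_cons -IH -RintegralZl//; last exact: bdd_meas_integrable.
by rewrite RintegralD//; apply: bdd_meas_integrable => //; exact: bdd_meas_sum.
Qed.

Lemma qform_Rintegral N (F : 'I_N -> 'I_N -> 'rV[R]_d -> R) (x : 'cV[R]_N) :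
  (forall k j, bdd_meas (F k j)) ->
  qform (\matrix_(k, j) Rintegral mu U (F k j)) x =
  Rintegral mu U (fun y => qform (\matrix_(k, j) F k j y) x).
Proof.
move=> bF; rewrite qform_sum pair_big/=; under eq_bigr do rewrite mxE.
rewrite -(Rintegral_lin_sum _ (fun kj => x kj.1 0 * x kj.2 0)
  (fun kj => bF kj.1 kj.2)).
apply: eq_Rintegral => y _; rewrite qform_sum pair_big/=.
by apply: eq_bigr => kj _; rewrite mxE.
Qed.

Lemma psd_Rintegral N (F : 'I_N -> 'I_N -> 'rV[R]_d -> R) :
  (forall k j, bdd_meas (F k j)) ->
  (forall y, U y -> psd (\matrix_(k, j) F k j y)) ->
  psd (\matrix_(k, j) Rintegral mu U (F k j)).
Proof.
move=> bF Fpsd; split=> [|x].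
  apply/matrixP => k j; rewrite !mxE; apply: eq_Rintegral => y.
  by rewrite inE => /Fpsd[/matrixP/(_ k j) + _]; rewrite !mxE.
by rewrite qform_Rintegral//; apply: Rintegral_ge0 => y /Fpsd[].
Qed.

Lemma Rintegral_continuous_gt0 g x0 : {in U, continuous g} -> bdd_meas g ->
  (forall x, U x -> 0 <= g x) -> U x0 -> 0 < g x0 -> 0 < Rintegral mu U g.
Proof.
move=> cg bg g0 Ux0 gx0; have Ig := bdd_meas_integrable bg.
pose a := g x0 / 2; have a0 : 0 < a by rewrite divr_gt0.
pose V := U `&` [set x | a < g x].
have oV : open V.
  rewrite openE => x [Ux /= agx]; apply: filterI; first exact: open_nbhs_nbhs.
  exact: (cvgr_gt _ (cg x (mem_set Ux))).
have V0 : V !=set0.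
  by exists x0; split; rewrite //= /a ltr_pdivrMr// ltr_pMr// ltr1n.
rewrite -lte_fin fineK; last exact: integrable_fin_num.
under eq_integral => x /set_mem Ux.
  rewrite -[(g x)%:E]gee0_abs ?lee_fin ?g0//; over.
apply: lt_le_trans (le_integral_abse mu mU (measurable_int _ Ig) a0).
rewrite mule_gt0 ?lte_fin//; apply: lt_le_trans (open_lebesgue_rV_gt0 oV V0) _.
apply: le_measure; rewrite ?inE.
- exact: open_measurable_rV.
- apply: emeasurable_fun_c_infty => //.
  by apply: measurableT_comp => //; exact: measurable_int Ig.
- move=> x [Ux /= agx]; split=> //=.
  by rewrite lee_fin ler_normr (ltW agx).
Qed.

End bounded_measurable.

(** * Directional derivatives of piecewise affine functions *)

Lemma interval_near_at_right (R : realFieldType) (E : set R) (a : R) :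
  is_interval E -> (\forall h \near a^'+, E h) \/ (\forall h \near a^'+, ~ E h).
Proof.
move=> itvE.
have [|freqE] := pselect (\forall h \near a^'+, ~ E h); first by right.
have E_below b : a < b -> exists2 h, a < h < b & E h.
  move=> ab; apply: contrapT => /forall2NP noE; apply: freqE; near=> h.
  have [hab|//] := noE h; case: hab; apply/andP; split.
    by near: h; exact: nbhs_right_gt.
  by near: h; exact: nbhs_right_lt.
have [|q /andP[aq _] Eq] := E_below (a + 1); first by rewrite ltrDl.
left; near=> h.
have ah : a < h by near: h; exact: nbhs_right_gt.
have hq : h < q by near: h; exact: nbhs_right_lt.
have [p /andP[_ ph] Ep] := E_below h ah.
by apply: (itvE p q Ep Eq); rewrite !ltW.
Unshelve. all: by end_near. Qed.

Section right_derivatives.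
Context {R : realType} {V : normedModType R}.
Implicit Types (f : V -> R) (v x : V).

Definition right_quotient f v x (h : R) : R := h^-1 *: (f (h *: v + x) - f x).

Definition right_derivable f v x := cvg (right_quotient f v x h @[h --> 0^'+]).

Definition right_derive f v x : R := lim (right_quotient f v x h @[h --> 0^'+]).

Lemma ray_cvg v x : h *: v + x @[h --> (0 : R)] --> x.
Proof.
rewrite -[X in _ --> X]add0r -(scale0r v).
by apply: cvgD; [exact: scalel_continuous|exact: cvg_cst].
Qed.

Lemma right_derive_ray_affine f v x (c g : R) : {for x, continuous f} ->
  (\forall h \near 0^'+, f (h *: v + x) = c + h * g) ->
  right_quotient f v x h @[h --> 0^'+] --> g.
Proof.
move=> cf fE; have fx : c = f x.
  have f_lim : f (h *: v + x) @[h --> (0 : R)^'+] --> f x.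
    apply: cvg_at_right_filter.
    by apply: continuous_cvg; [exact: cf|exact: (ray_cvg v)].
  have affine_lim : c + h * g @[h --> (0 : R)^'+] --> c.
    rewrite [X in _ --> X](_ : c = c + 0 * g); last by rewrite mul0r addr0.
    apply: cvg_at_right_filter.
    apply: cvgD; first exact: cvg_cst.
    by apply: cvgM; [exact: cvg_id|exact: cvg_cst].
  have f_lim_c : f (h *: v + x) @[h --> (0 : R)^'+] --> c.
    apply: cvg_trans affine_lim; apply: near_eq_cvg.
    by apply: filterS fE => h ->.
  exact: (cvg_unique _ f_lim_c f_lim).
apply: cvg_near_cst; near=> h.
rewrite /right_quotient (near fE h)// fx addrAC subrr add0r.
by rewrite /GRing.scale/= mulKf.
Unshelve. all: by end_near. Qed.

Lemma derive_right_left f v x :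
  right_derivable f v x -> right_derivable f (- v) x ->
  'D_v f x = if right_derive f v x == - right_derive f (- v) x
             then right_derive f v x else point.
Proof.
move=> fv fNv; set gp := right_derive f v x; set gm := right_derive f (- v) x.
pose q := right_quotient f v x.
have q_right : q h @[h --> 0^'+] --> gp by exact: fv.
have q_left : q h @[h --> 0^'-] --> - gm.
  apply/cvg_at_leftNP; rewrite oppr0.
  rewrite (_ : q \o -%R = - right_quotient f (- v) x); first exact: cvgN.
  apply/funext => h; rewrite /q /right_quotient /= fctE.
  by rewrite invrN !scaleNr scalerN.
rewrite /derive -/q; case: eqP => [e|ne].
  apply: cvg_lim => //; rewrite -e in q_left.
  exact: (@cvg_at_right_left_dnbhs _ R^o) q_right q_left.
apply: xgetPN => l ql; apply: ne.
have ql_right := cvg_dnbhs_at_right ql; have ql_left := cvg_dnbhs_at_left ql.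
have -> : gp = l by exact: cvg_unique q_right ql_right.
exact: cvg_unique ql_left q_left.
Qed.

End right_derivatives.

Section right_derive_measurable.
Context {R : realType} {d : nat} (Omega : set 'rV[R]_d) (f : 'rV[R]_d -> R).
Hypotheses (oO : open Omega) (cf : {in Omega, continuous f}).

Lemma ray_near v x : Omega x -> \forall h \near (0 : R), Omega (h *: v + x).
Proof.
by move=> Ox; apply: (ray_cvg v (t := Omega)); exact: open_nbhs_nbhs.
Qed.

Lemma right_derive_measurable v :
  (forall x, Omega x -> right_derivable f v x) ->
  measurable_fun Omega (right_derive f v).
Proof.
move=> fv; have mO := open_measurable_rV oO.
have mf : measurable_fun Omega f by exact: open_continuous_measurable_rV.
pose t n : R := n.+1%:R^-1; have t_gt0 n : 0 < t n by rewrite invr_gt0.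
have t0 : t n @[n --> \oo] --> 0 by exact: cvg_harmonic.
apply: (@measurable_fun_cvg _ _ _ Omega
  (fun n x => (t n)^-1 * ((f \_ Omega) (t n *: v + x) - f x))).
  move=> n; apply: measurable_funM; first exact: measurable_cst.
  apply: measurable_funB => //; apply: measurable_funTS.
  apply: (@measurableT_comp _ _ _ _ _ _ (f \_ Omega)).
    by apply/(measurable_restrictT _ mO).
  apply: measurable_fun_rVP => i.
  rewrite (_ : _ \o _ = fun x => t n * v ord0 i + rV_coord i x).
    apply: measurable_funD; first exact: measurable_cst.
    exact: measurable_rV_coord.
  by apply/funext => x /=; rewrite /rV_coord !mxE.
move=> x Ox; have /cvg_at_rightP/(_ t) := fv x Ox.
move=> /(_ (conj t_gt0 t0)); apply: cvg_trans; apply: near_eq_cvg.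
near=> n; rewrite patchE mem_set//; near: n.
exact: (t0 [set h | Omega (h *: v + x)] (ray_near v Ox)).
Unshelve. all: by end_near. Qed.

End right_derive_measurable.

Section vertex_hulls.
Context {R : realType} {d nv : nat} (vert : 'I_nv -> 'rV[R]_d).
Implicit Types (e : {set 'I_nv}) (v x y : 'rV[R]_d) (f : 'rV[R]_d -> R).

Lemma vhull_convex e x y t : 0 <= t -> t <= 1 ->
  vhull vert e x -> vhull vert e y -> vhull vert e ((1 - t) *: x + t *: y).
Proof.
move=> t0 t1 [b [b0 be b1 ->]] [c [c0 ce c1 ->]].
exists (fun i => (1 - t) * b i + t * c i); split.
- by move=> i; rewrite addr_ge0// mulr_ge0// subr_ge0.
- by move=> i ie; rewrite be// ce// !mulr0 addr0.
- by rewrite big_split/= -!big_distrr/= b1 c1 !mulr1 subrK.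
- rewrite !scaler_sumr -big_split; apply: eq_bigr => i _ /=.
  by rewrite [RHS]scalerDl !scalerA.
Qed.

Lemma is_interval_ray_vhull e v x :
  is_interval [set h : R | vhull vert e (h *: v + x)].
Proof.
move=> p q /= Ep Eq h /andP[ph hq]; have [pq|pq] := eqVneq p q.
  by have -> : h = p by apply/le_anti; rewrite ph pq hq.
have {pq}qp0 : 0 < q - p by rewrite subr_gt0 lt_neqAle pq (le_trans ph).
pose t := (h - p) / (q - p); have t0 : 0 <= t.
  by rewrite divr_ge0 ?(ltW qp0)// subr_ge0.
have t1 : t <= 1 by rewrite ler_pdivrMr// mul1r lerD2r.
have -> : h *: v + x = (1 - t) *: (p *: v + x) + t *: (q *: v + x).
  rewrite !scalerDr !scalerA addrACA -!scalerDl subrK scale1r.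
  by congr (_ *: _ + _); rewrite /t; field; rewrite gt_eqF.
exact: vhull_convex.
Qed.

Lemma vhull_vert e i : i \in e -> vhull vert e (vert i).
Proof.
move=> ie; exists (fun j => (j == i)%:R); split=> [j|j||].
- exact: ler0n.
- by case: eqVneq => // -> /negP.
- by rewrite (bigD1 i)//= eqxx big1 ?addr0// => j /negbTE ->.
- by rewrite sum_delta_scale.
Qed.

Lemma affine_on_vhull_norm_le e f C x :
  affine_on (vhull vert e) f -> (forall i, `|f (vert i)| <= C) ->
  vhull vert e x -> `|f x| <= C.
Proof.
move=> [a [b fE]] fC ex; rewrite fE//; have [c [c0 ce c1 ->]] := ex.
have -> : ((\sum_i c i *: vert i) *m a) 0 0 + b = \sum_i c i * f (vert i).
  rewrite mulmx_suml summxE -[b]mul1r -c1 big_distrl/= -big_split/=.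
  apply: eq_bigr => i _; rewrite -scalemxAl mxE -mulrDr.
  have [ie|ie] := boolP (i \in e); last by rewrite ce// !mul0r.
  by rewrite fE//; exact: vhull_vert.
apply: (le_trans (ler_norm_sum _ _ _)); rewrite -[leRHS]mul1r -c1 big_distrl/=.
by apply: ler_sum => i _; rewrite normrM ger0_norm// ler_wpM2l.
Qed.

End vertex_hulls.

Section piecewise_affine.
Context {R : realType} {d : nat} (Omega : set 'rV[R]_d).
Context (nv : nat) (vert : 'I_nv -> 'rV[R]_d) (elts : {set {set 'I_nv}}).
Hypotheses (oO : open Omega).
Hypothesis cover : forall x, Omega x -> exists2 e, e \in elts & vhull vert e x.
Implicit Types (v x : 'rV[R]_d).

Lemma ray_near_element v x : Omega x -> exists2 e, e \in elts &
  \forall h \near (0 : R)^'+, vhull vert e (h *: v + x).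
Proof.
move=> Ox; apply: contrapT => /forall2NP noelt.
have elt_avoided e : \forall h \near (0 : R)^'+,
    e \in elts -> ~ vhull vert e (h *: v + x).
  have ray_itv := @is_interval_ray_vhull _ _ _ vert e v x.
  have [ev|evN] := interval_near_at_right 0 ray_itv.
    by have [e_notin|//] := noelt e; near=> h.
  by apply: filterS evN => h.
have /filter_ex[h [Oh avoided]] : \forall h \near (0 : R)^'+,
    Omega (h *: v + x) /\ forall e, e \in elts -> ~ vhull vert e (h *: v + x).
  near=> h; split; near: h; last exact: filter_forall.
  by apply: cvg_within; exact: ray_near.
by have [e ee /(avoided e ee)] := cover Oh.
Unshelve. all: by end_near. Qed.

Context (f : 'rV[R]_d -> R).
Hypothesis cf : {in Omega, continuous f}.
Hypothesis af : forall e, e \in elts -> affine_on (vhull vert e) f.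

Lemma right_derive_bounded v : exists C : R, forall x, Omega x ->
  right_derivable f v x /\ `|right_derive f v x| <= C.
Proof.
have /choice[ab abE] : forall e : {set 'I_nv}, exists ab : 'cV[R]_d * R,
    e \in elts -> forall x, vhull vert e x -> f x = (x *m ab.1) 0 0 + ab.2.
  move=> e; have [ee|ee] := boolP (e \in elts); last by exists (0, 0).
  by have [a [b abE]] := af ee; exists (a, b).
pose slope e := (v *m (ab e).1) 0 0.
exists (\sum_e `|slope e|) => x Ox; have [e ee ev] := ray_near_element v Ox.
have fv : right_quotient f v x h @[h --> 0^'+] --> slope e.
  apply: (@right_derive_ray_affine _ _ _ _ _ ((x *m (ab e).1) 0 0 + (ab e).2)).
    exact: cf (mem_set Ox).
  near=> h; rewrite (abE e ee); last by near: h.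
  by rewrite mulmxDl -scalemxAl /slope !mxE; ring.
split; first by apply/cvg_ex; exists (slope e).
rewrite /right_derive (cvg_lim _ fv)//.
by rewrite (bigD1 e)//= lerDl sumr_ge0.
Unshelve. all: by end_near. Qed.

Lemma derive_bdd_meas v : bdd_meas Omega (fun x => 'D_v f x).
Proof.
have mO := open_measurable_rV oO.
have [C fvC] := right_derive_bounded v.
have [C' fNvC] := right_derive_bounded (- v).
apply: (@eq_bdd_meas _ _ _ (fun x =>
    if right_derive f v x == - right_derive f (- v) x
    then right_derive f v x else point)).
  move=> x Ox; rewrite derive_right_left//; first by have [] := fvC x Ox.
  by have [] := fNvC x Ox.
have mp : measurable_fun Omega (right_derive f v).
  by apply: right_derive_measurable => // x /fvC[].
have mm : measurable_fun Omega (right_derive f (- v)).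
  by apply: right_derive_measurable => // x /fNvC[].
split.
  apply: measurable_fun_if => //.
    by apply: measurable_fun_eqr => //; exact: measurableT_comp.
  by apply: measurable_funS mp => // x [].
exists (C + `|point : R|) => x Ox; have [_ gC] := fvC x Ox.
case: eqP => _; first exact: ler_wpDr.
by rewrite lerDr (le_trans _ gC).
Qed.

End piecewise_affine.

(** * Mass and stiffness matrices *)

Lemma cvg_lin_comb (R : realType) (T : Type) (F : set_system T) (I : Type)
    (r : seq I) (c : I -> R) (f : I -> T -> R) (l : I -> R) : Filter F ->
  (forall i, f i z @[z --> F] --> l i) ->
  \sum_(i <- r) c i * f i z @[z --> F] --> \sum_(i <- r) c i * l i.
Proof.
move=> FF fl; apply: cvg_big => [|i _]; first exact: add_continuous.
by apply: cvgM; [exact: cvg_cst|exact: fl].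
Qed.

Section finite_element_matrices.
Context {R : realType} {d : nat} (Omega : set 'rV[R]_d).
Context (nv : nat) (vert : 'I_nv -> 'rV[R]_d) (elts : {set {set 'I_nv}}).
Context (N : nat) (iv : 'I_N -> 'I_nv) (phi : 'I_N -> 'rV[R]_d -> R).
Hypothesis hOmega : bounded_domain Omega.
Hypothesis hmesh : simplicial_mesh Omega vert elts.
Hypothesis hphi : nodal_basis Omega vert elts iv phi.

Let oO : open Omega. Proof. by case: hOmega. Qed.
Let bO : bounded_set Omega. Proof. by case: hOmega. Qed.

Lemma mesh_cover x : Omega x -> exists2 e, e \in elts & vhull vert e x.
Proof.
move=> Ox; have [_ _ _ closureE _] := hmesh.
have : closure Omega x by exact: subset_closure.
by rewrite closureE => -[e ee ex]; exists e.
Qed.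

Lemma nodal_basis_continuous k : {in Omega, continuous (phi k)}.
Proof.
have [ck _ _] := hphi k; rewrite -(continuous_open_subspace _ oO).
exact: continuous_subspaceW (@subset_closure _ Omega) ck.
Qed.

Lemma nodal_basis_bdd_meas k : bdd_meas Omega (phi k).
Proof.
have [_ ak vk] := hphi k; split.
  by apply: open_continuous_measurable_rV => //; exact: nodal_basis_continuous.
exists 1 => x Ox; have [e ee ex] := mesh_cover Ox.
apply: affine_on_vhull_norm_le ex; first exact: ak.
by move=> i; rewrite vk; case: (_ == _); rewrite ?normr1 ?normr0.
Qed.

Lemma grad_nodal_basis_bdd_meas k i :
  bdd_meas Omega (fun x => grad (phi k) x 0 i).
Proof.
have [_ ak _] := hphi k; have ck := @nodal_basis_continuous k.
apply: eq_bdd_meas (derive_bdd_meas oO mesh_cover ck ak (delta_mx ord0 i)).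
by move=> x _; rewrite mxE.
Qed.

Let mass_integrand y : \matrix_(k, j) (phi k y * phi j y) =
  (\row_k phi k y)^T *m \row_k phi k y.
Proof. by apply/matrixP => k j; rewrite !mxE big_ord1 !mxE. Qed.

Hypothesis hiv : interior_numbering Omega vert iv.

Lemma mass_matrix_spd : spd (mass_matrix Omega phi).
Proof.
have phi2_bdd k j : bdd_meas Omega (fun x => phi k x * phi j x).
  by apply: bdd_measM; exact: nodal_basis_bdd_meas.
have [Msym _] : psd (mass_matrix Omega phi).
  apply: psd_Rintegral => // y _; rewrite mass_integrand -[X in X *m _]mulmx1.
  by apply: psd_congr; exact: psd1.
split=> // x x0; rewrite -/(qform _ x) (qform_Rintegral oO bO)//.
pose f y := \sum_k x k 0 * phi k y.
have -> : (fun y => qform (\matrix_(k, j) (phi k y * phi j y)) x) =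
    fun y => f y * f y.
  apply/funext => y.
  rewrite mass_integrand qform_gram qform1E big_ord1 expr2 mxE.
  by congr (_ * _); apply: eq_bigr => k _; rewrite mxE mulrC.
have f_continuous : {in Omega, continuous f}.
  move=> y Oy; apply: (@cvg_lin_comb _ _ (nbhs y) _ _ (fun k => x k 0)) => k.
  exact: nodal_basis_continuous.
have f_bdd : bdd_meas Omega f.
  by apply: bdd_meas_sum => k; apply: bdd_measZ; exact: nodal_basis_bdd_meas.
have /matrix0Pn[k [j xk]] := x0; rewrite {j}ord1 in xk.
have [iv_inj Oiv] := hiv; have Ok : Omega (vert (iv k)) by apply/Oiv; exists k.
have fk : f (vert (iv k)) = x k 0.
  rewrite /f (bigD1 k)//= big1 => [|i ik].
    by have [_ _ ->] := hphi k; rewrite eqxx mulr1 addr0.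
  by have [_ _ ->] := hphi i; rewrite (inj_eq iv_inj) eq_sym (negbTE ik) mulr0.
apply: (Rintegral_continuous_gt0 oO bO _ _ _ Ok).
- by move=> y Oy; apply: (@cvgM _ _ (nbhs y)); exact: f_continuous.
- exact: bdd_measM.
- by move=> y _; rewrite -expr2 sqr_ge0.
- by rewrite -expr2 exprn_even_gt0//= fk.
Qed.

Context (D : 'rV[R]_d -> 'M[R]_d) (dmin dmax : R).
Hypothesis hD : diffusion Omega D dmin dmax.

Lemma diffusion_psd x : Omega x -> psd (D x).
Proof.
have [dmin0 _ _ DE] := hD => /DE[Dsym Dlb _]; split=> // y.
apply: le_trans (Dlb y); rewrite -/(qform _ y) qform_scalar -sqr_l2norm.
by rewrite mulr_ge0 ?sqr_ge0 ?(ltW dmin0).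
Qed.

Lemma diffusion_bdd_meas i j : bdd_meas Omega (fun x => D x i j).
Proof.
have [_ _ mD DE] := hD; split=> //; exists dmax => x Ox.
by apply: psd_loewner_coef_le; [exact: diffusion_psd|have [] := DE x Ox].
Qed.

Lemma stiffness_matrix_psd : psd (stiffness_matrix Omega D phi).
Proof.
apply: psd_Rintegral => // [k j|y Oy].
  apply: (@eq_bdd_meas _ _ _ (fun y => \sum_i
      (\sum_l grad (phi k) y 0 l * D y l i) * grad (phi j) y 0 i)).
    by move=> y _; rewrite mxE; apply: eq_bigr => i _; rewrite !mxE.
  apply: bdd_meas_sum => i.
  apply: bdd_measM; last exact: grad_nodal_basis_bdd_meas.
  apply: bdd_meas_sum => l; apply: bdd_measM; last exact: diffusion_bdd_meas.
  exact: grad_nodal_basis_bdd_meas.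
pose G : 'M[R]_(d, N) := \matrix_(i, k) grad (phi k) y 0 i.
rewrite (_ : \matrix_(k, j) _ = G^T *m D y *m G); last first.
  apply/matrixP => k j; rewrite mxE !mxE; apply: eq_bigr => i _; rewrite !mxE.
  by congr (_ * _); apply: eq_bigr => l _; rewrite !mxE.
by apply: psd_congr; exact: diffusion_psd.
Qed.

End finite_element_matrices.

Unset Implicit Arguments.
Set Strict Implicit.

Theorem theorem5p2 (R : realType) (d : nat) (hd : (0 < d)%N)
    (Omega : set 'rV[R]_d) (hOmega : bounded_domain Omega)
    (nv : nat) (vert : 'I_nv -> 'rV[R]_d) (elts : {set {set 'I_nv}})
    (hmesh : simplicial_mesh Omega vert elts)
    (N : nat) (hN : (0 < N)%N) (iv : 'I_N -> 'I_nv)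
    (hiv : interior_numbering Omega vert iv)
    (phi : 'I_N -> 'rV[R]_d -> R) (hphi : nodal_basis Omega vert elts iv phi)
    (D : 'rV[R]_d -> 'M[R]_d) (dmin dmax : R) (hD : diffusion Omega D dmin dmax)
    (M A : 'M[R]_N) (hM : M = mass_matrix Omega phi)
    (hA : A = stiffness_matrix Omega D phi)
    (dt : R) (hdt : 0 < dt)
    (s : nat) (Gamma : 'M[R]_s)
    (hGamma : forall z : R[i],
      eigenvalue (map_mx (real_complex R) Gamma) z -> 0 <= complex.Re z)
    (T : 'M[R]_s) (p : nat) (B : 'I_p -> jordan_block R)
    (hs : (\sum_(q < p) jb_len (B q) * jb_dim (B q))%N = s)
    (hJ : real_jordan_form Gamma T hs) :
  (* the mu_j and alpha_j +- i beta_j are the real and complex eigenvalues *)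
  [/\ (forall x : R, eigenvalue Gamma x <-> exists q m, B q = RealBlock x m),
      (forall z : R[i], complex.Im z != 0 ->
        (eigenvalue (map_mx (real_complex R) Gamma) z <->
         exists q alpha beta m, B q = CplxBlock alpha beta m /\
           (z = alpha +i* beta \/ z = alpha +i* (- beta)))),
  (* the stage system amounts to the smaller systems *)
      [/\ transformed_stage_mx M A dt Gamma T = stage_mx M A dt (jordan_mx hs),
          (forall (u : 'cV[R]_N) (v : 'I_s -> 'cV[R]_N),
            stage_system M A dt Gamma u v <->
            jordan_substitution M A dt T hs u v),
          (forall q mu m, B q = RealBlock mu m -> spd (M + (mu * dt) *: A)),
          (forall q alpha beta m, B q = CplxBlock alpha beta m ->
            posdef (sym_part (1%:M *t M + dt *: (rot_mx alpha beta *t A))))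
        & rk_conditioning M A dt Gamma T hs =
          \big[Num.max/0]_(q < p) block_cond M A dt (B q)]
  (* the bound for the preconditioned systems *)
    & forall P : 'M[R]_N, spd P ->
      forall q alpha beta m, B q = CplxBlock alpha beta m ->
      let Q := mx_invsqrt P in
      let PB := ((1%:M : 'M[R]_2) *t Q)
                *m (1%:M *t M + dt *: (rot_mx alpha beta *t A))
                *m (1%:M *t Q) in
      posdef (sym_part PB) /\
      cond_tilde PB <=
        (lambda_max (Q *m M *m Q)
         + dt * Num.sqrt (alpha ^+ 2 + beta ^+ 2) * lambda_max (Q *m A *m Q))
        / (lambda_min (Q *m M *m Q) + dt * alpha * lambda_min (Q *m A *m Q))].
Proof.
have Mspd : spd M by rewrite hM; exact: (mass_matrix_spd hOmega hmesh hphi hiv).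
have Apsd : psd A.
  by rewrite hA; exact: (stiffness_matrix_psd hOmega hmesh hphi hD).
have dt0 := ltW hdt.
have mu_ge0 := jordan_form_mu_ge0 hJ hGamma.
have alpha_ge0 := jordan_form_alpha_ge0 hJ hGamma.
split.
- exact: jordan_form_real_eigenvalue hJ.
- exact: jordan_form_complex_eigenvalue hJ.
- split.
  + exact: transformed_stage_mx_jordan.
  + by move=> u v; exact: jordan_substitutionP.
  + move=> q mu m /mu_ge0 mu0; apply: spdD_psd => //.
    by apply: psdZ => //; exact: mulr_ge0.
  + by move=> q alpha beta m /alpha_ge0 alpha0; exact: cplx_coef_posdef.
  + exact: rk_conditioningE.
- move=> P Pspd q alpha beta m /alpha_ge0 alpha0.
  exact: precond_cplx_coef_cond_le.
Qed.
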